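(* Let $d\ge 3$. There exists a constant $\alpha>0$ (depending only on $d$) such that for every $r\ge 1$ and every finite $\mathcal{C}\subset \mathbb{Z}^d$, there is a subset $U\subseteq \mathcal{C}$ satisfying $$(i)\quad \mathrm{cap}(B_r(U))\ge \alpha\, r^{d-2}\,|U| \qquad\text{and}\qquad (ii)\quad r^{d-2}\,|U|\ge \alpha\,\mathrm{cap}(B_r(\mathcal{C})).$$
   Context: $\|\cdot\|$ is the Euclidean norm. For $x\in\mathbb{Z}^d$ and $r\ge 1$ real, $B_r(x)=\{z\in\mathbb{Z}^d:\|z-x\|<r\}$, and for $\mathcal{C}\subset\mathbb{Z}^d$, $B_r(\mathcal{C})=\bigcup_{x\in\mathcal{C}}B_r(x)$. $|U|$ denotes cardinality. Let $\mathbb{P}_x$ be the law of the simple random walk $(S_n)_{n\ge 0}$ on $\mathbb{Z}^d$ started at $x$, and $H^+_\Lambda=\inf\{n\ge 1: S_n\in\Lambda\}$ the return time to $\Lambda\subset\mathbb{Z}^d$. The capacity of a finite set $\Lambda\subset \mathbb{Z}^d$ is $\mathrm{cap}(\Lambda)=\sum_{x\in\Lambda}\mathbb{P}_x(H^+_\Lambda=\infty)$. *)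

(* Defs.v *)
From HB Require Import structures.
From mathcomp Require Import all_boot all_order all_algebra finmap.
From mathcomp Require Import all_classical all_reals all_analysis.
From mathcomp Require Import zify.

Set Implicit Arguments.
Unset Strict Implicit.
Unset Printing Implicit Defensive.

Import Order.TTheory GRing.Theory Num.Theory.

Local Open Scope classical_set_scope.
Local Open Scope ring_scope.

(* The lattice Z^d is the type 'rV[int]_d. *)

Definition enorm (R : realType) (d : nat) (x : 'rV[int]_d) : R :=
  Num.sqrt (\sum_(i < d) (x ord0 i)%:~R ^+ 2).

Definition lattice_ball (R : realType) (d : nat) (r : R) (x : 'rV[int]_d) :
  set 'rV[int]_d := [set z | enorm R (z - x) < r].

Definition lattice_nbhd (R : realType) (d : nat) (r : R)
    (C : set 'rV[int]_d) : set 'rV[int]_d :=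
  \bigcup_(x in C) lattice_ball r x.

Definition step_prob (R : realType) (d : nat) (x y : 'rV[int]_d) : R :=
  if enorm R (y - x) == 1 then ((2 * d)%:R)^-1 else 0.

(* Under P, the process S is the simple random walk on Z^d started at x.
   Z^d carries the discrete sigma-algebra, hence measurability of S n is
   tested on singletons; the finite-dimensional distributions determine the
   law of the whole trajectory. *)
Definition simple_random_walk (R : realType) (d : nat)
    (disp : measure_display) (Omega : measurableType disp)
    (P : probability Omega R) (S : nat -> Omega -> 'rV[int]_d)
    (x : 'rV[int]_d) : Prop :=
  (forall n y, measurable [set w | S n w = y]) /\
  (forall (n : nat) (y : nat -> 'rV[int]_d),
     P [set w | forall k, (k <= n)%N -> S k w = y k] =
     ((y 0%N == x)%:R * \prod_(k < n) step_prob R (y k) (y k.+1))%:E).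

Definition return_time (R : realType) (d : nat) (Omega : Type)
    (S : nat -> Omega -> 'rV[int]_d) (L : set 'rV[int]_d) (w : Omega) :
    \bar R :=
  ereal_inf [set (n%:R : R)%:E | n in [set n | (1 <= n)%N /\ L (S n w)]].

(* [P x] plays the role of the law of the walk started at x. The sum over a
   classical set is a finite sum: it is meaningful for finite L only. *)
Definition cap (R : realType) (d : nat)
    (disp : measure_display) (Omega : measurableType disp)
    (P : 'rV[int]_d -> probability Omega R) (S : nat -> Omega -> 'rV[int]_d)
    (L : set 'rV[int]_d) : R :=
  \sum_(x \in L) fine (P x [set w | return_time R S L w = +oo%E]).

Lemma finite_lattice_nbhd (R : realType) (d : nat) (r : R)
  (C : set 'rV[int]_d) : finite_set C -> finite_set (lattice_nbhd r C).
Proof.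
move=> fC; apply: bigcup_finite => // x _.
pose n := Num.truncn r.
pose f (g : {ffun 'I_d -> 'I_(2 * n).+1}) : 'rV[int]_d :=
  \row_i (x ord0 i + (g i)%:Z - n%:Z).
apply: (@sub_finite_set _ _ (range f)); last exact/finite_image/finite_finset.
move=> z zr; have zn i : `|z ord0 i - x ord0 i| <= n%:Z.
  have r0 : 0 <= r by apply: ltW; apply: le_lt_trans zr; exact: sqrtr_ge0.
  rewrite -ltzD1 -(ltr_int R).
  apply: le_lt_trans (lt_trans zr _); last first.
    by rewrite addrC -intS; exact: truncnS_gt.
  rewrite /enorm intr_norm -sqrtr_sqr ler_wsqrtr// (bigD1 i)//= !mxE lerDl.
  by apply: sumr_ge0 => j _; exact: sqr_ge0.
exists [ffun i => inord (absz (z ord0 i - x ord0 i + n%:Z))] => //.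
apply/rowP => i; have := zn i; rewrite ler_norml !mxE ffunE => /andP[].
move: (z ord0 i) (x ord0 i) => a b ? ?.
by rewrite inordK; lia.
Qed.

(* Existence of the walk, by reading the successive steps in the digits in base
   2d of a uniform real number. *)

Definition unit_step (d i : nat) : 'rV[int]_d :=
  \row_(j < d) (((j : nat) == i)%:R - ((j + d)%N == i)%:R).

Lemma enorm_unit_step (R : realType) (d i : nat) :
  (i < 2 * d)%N -> enorm R (unit_step d i) = 1.
Proof.
move=> id.
have [k [b kb]] : exists (k : 'I_d) (b : bool),
    unit_step d i = (-1) ^+ b *: delta_mx ord0 k.
  have [lt_id|le_di] := ltnP i d.
    exists (Ordinal lt_id), false; apply/rowP => j.
    rewrite !mxE eqxx/= expr0 mul1r -val_eqE/=.
    have -> : ((j + d)%N == i) = false by lia.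
    by rewrite subr0.
  have lt_id : (i - d < d)%N by lia.
  exists (Ordinal lt_id), true; apply/rowP => j.
  rewrite !mxE eqxx/= expr1 -val_eqE/=.
  have -> : ((j : nat) == i) = false by have := ltn_ord j; lia.
  have -> : ((j + d)%N == i) = ((j : nat) == i - d)%N by lia.
  by rewrite sub0r mulN1r.
rewrite /enorm kb (bigD1 k)//= big1 ?addr0.
  by rewrite !mxE !eqxx/= mulr1 rmorphXn/= rmorphN1 sqrr_sign sqrtr1.
by move=> j jk; rewrite !mxE (negbTE jk) andbF mulr0 expr0n.
Qed.

Lemma enorm1P (R : realType) (d : nat) (z : 'rV[int]_d) :
  enorm R z = 1 -> exists2 i, (i < 2 * d)%N & z = unit_step d i.
Proof.
move=> z1.
have sz : \sum_(i < d) z ord0 i ^+ 2 = 1.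
  apply: (@intr_inj R); rewrite rmorph_sum/=.
  under eq_bigr do rewrite rmorphXn/=.
  have s0 : 0 <= \sum_(i < d) (z ord0 i)%:~R ^+ 2 :> R.
    by apply: sumr_ge0 => i _; exact: sqr_ge0.
  by rewrite -(sqr_sqrtr s0) -[Num.sqrt _]/(enorm R z) z1 expr1n.
have [k zk] : exists k, z ord0 k != 0.
  apply: contrapT => /forallNP z0; move: sz; rewrite big1// => i _.
  by have /negP := z0 i; rewrite negbK => /eqP ->; rewrite expr0n.
move: sz; rewrite (bigD1 k)//= => sz.
have s0 : 0 <= \sum_(i < d | i != k) z ord0 i ^+ 2.
  by apply: sumr_ge0 => i _; exact: sqr_ge0.
have zk2 : 1 <= z ord0 k ^+ 2 by rewrite -gtz0_ge1 lt0r sqrf_eq0 zk sqr_ge0.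
have rest0 : \sum_(i < d | i != k) z ord0 i ^+ 2 = 0.
  by apply/eqP; rewrite eq_le s0 andbT -(lerD2l (z ord0 k ^+ 2)) sz addr0.
have /eqP : z ord0 k ^+ 2 = 1 by rewrite -sz rest0 addr0.
rewrite sqrf_eq1 => zk1.
move/eqP: rest0; rewrite psumr_eq0; last by move=> i _; exact: sqr_ge0.
move=> /allP zj0.
have kd := ltn_ord k.
have zj j : j != k -> z ord0 j = 0.
  move=> jk; have := zj0 j (mem_index_enum _).
  by rewrite jk/= sqrf_eq0 => /eqP.
case/orP: zk1 => /eqP zk1.
  exists (k : nat); first by lia.
  apply/rowP => j; rewrite !mxE.
  have -> : ((j + d)%N == k) = false by lia.
  have [jk|jk] := eqVneq j k; first by rewrite jk zk1 eqxx subr0.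
  by rewrite zj// (_ : (j : nat) == k = false) ?subr0//; apply/negbTE.
exists (k + d)%N; first by lia.
apply/rowP => j; rewrite !mxE.
have -> : ((j : nat) == k + d)%N = false by have := ltn_ord j; lia.
rewrite eqn_add2r.
have [jk|jk] := eqVneq j k; first by rewrite jk zk1 eqxx sub0r.
by rewrite zj// (_ : (j : nat) == k = false) ?subr0//; apply/negbTE.
Qed.

Lemma unit_step_inj (d i j : nat) : (i < 2 * d)%N -> (j < 2 * d)%N ->
  unit_step d i = unit_step d j -> i = j.
Proof.
move=> id jd /rowP ij.
have [lt_id|le_di] := ltnP i d.
  have := ij (Ordinal lt_id); rewrite !mxE/= eqxx.
  by lia.
have lt_id : (i - d < d)%N by lia.
have := ij (Ordinal lt_id); rewrite !mxE/= subnK// eqxx.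
by lia.
Qed.

Fixpoint digit_walk (d n t : nat) : 'rV[int]_d :=
  if n is n'.+1 then
    digit_walk d n' (t %/ (2 * d))%N + unit_step d (t %% (2 * d))%N
  else odflt 0 (choice.unpickle t).

Definition digits (R : realType) (d n : nat) (w : R) : nat :=
  Num.truncn ((2 * d)%:R ^+ n * w).

Lemma digits_div (R : realType) (d n : nat) (w : R) : (0 < d)%N ->
  (digits d n.+1 w %/ (2 * d))%N = digits d n w.
Proof.
move=> d0; rewrite /digits exprS -mulrA.
set N := (2 * d)%N; set v := _ * w.
have N0 : 0 < N%:R :> R by rewrite ltr0n /N; lia.
have [v0|v0] := leP 0 v; last first.
  have t0 (u : R) : u < 0 -> Num.truncn u = 0%N.
    by move=> u0; apply/eqP; rewrite -leqn0 truncn_le_nat (lt_trans u0).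
  by rewrite !t0 ?div0n// pmulr_rlt0.
apply/esym/eqP; rewrite truncn_eq//.
have Nv0 : 0 <= N%:R * v by rewrite mulr_ge0// ltW.
have /andP[] := truncn_itv Nv0; set t := Num.truncn _ => le_t lt_t.
rewrite -(ler_pM2l N0) -(ltr_pM2l N0) -!natrM.
apply/andP; split.
  by apply: le_trans le_t; rewrite ler_nat mulnC leq_divM.
apply: lt_le_trans lt_t _; rewrite ler_nat mulnC.
by apply: ltn_ceil; rewrite /N; lia.
Qed.

Lemma measurable_digits (R : realType) (d n j : nat) : (0 < d)%N ->
  measurable [set w : measurableTypeR R | digits d n w = j].
Proof.
move=> d0.
have N0 : 0 < (2 * d)%:R ^+ n :> R by rewrite exprn_gt0// ltr0n; lia.
have mle k : measurable [set w : measurableTypeR R | (digits d n w <= k)%N].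
  rewrite (_ : mkset _ = `]-oo, (k.+1%:R / (2 * d)%:R ^+ n)[%classic).
    exact: measurable_itv.
  apply/seteqP; split => w /=;
    by rewrite /digits truncn_le_nat in_itv/= ltr_pdivlMr// mulrC.
case: j => [|j].
  rewrite (_ : mkset _ = [set w | (digits d n w <= 0)%N]).
    exact: mle.
  by apply/seteqP; split => w /=; [move->|rewrite leqn0 => /eqP].
rewrite (_ : mkset _ = [set w | (digits d n w <= j.+1)%N] `\`
                       [set w | (digits d n w <= j)%N]).
  exact: measurableD.
by apply/seteqP; split => w /=; [move=> ->; split => //; lia|case; lia].
Qed.

Section walk_existence.
Variables (R : realType) (d : nat) (hd : (0 < d)%N).

Let S (n : nat) (w : measurableTypeR R) : 'rV[int]_d :=
  digit_walk d n (digits d n w).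

Let ltS (m : nat) : (m%:R : R) < m.+1%:R.
Proof. by rewrite ltr_nat. Qed.

Let P (x : 'rV[int]_d) : probability (measurableTypeR R) R :=
  uniform_prob (ltS (choice.pickle x)).

Let PE x (U : set (measurableTypeR R)) : measurable U ->
  P x U = lebesgue_measure
    (U `&` `[(choice.pickle x)%:R, (choice.pickle x).+1%:R]%classic).
Proof.
move=> mU; rewrite /P/= /uniform_prob integral_uniform_pdf.
rewrite (eq_integral (fun=> 1%:E)); last first.
  move=> w; rewrite inE/= in_itv/= => -[_ wm].
  rewrite /uniform_pdf wm (_ : _.+1%:R - _ = 1) ?invr1//.
  by rewrite -natrB// subSnn.
by rewrite integral_cst ?mul1e//; apply: measurableI.
Qed.

Let P_digits x n j : (j %/ (2 * d) ^ n)%N = choice.pickle x ->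
  P x [set w | digits d n w = j] = (((2 * d)%:R ^+ n)^-1)%:E.
Proof.
move=> jx; rewrite PE; last exact: measurable_digits.
set m := choice.pickle x in jx *; set N := (2 * d)%N in jx *.
have N0 : 0 < N%:R ^+ n :> R by rewrite exprn_gt0// ltr0n /N; lia.
have Nn0 : (0 < N ^ n)%N by rewrite expn_gt0 /N; lia.
rewrite (_ : _ `&` _ =
    `[(j%:R / N%:R ^+ n), (j.+1%:R / N%:R ^+ n)[%classic); last first.
  apply/seteqP; split => w /=; rewrite !in_itv/= ler_pdivrMr// ltr_pdivlMr//.
    move=> [jw /andP[mw _]].
    have w0 : 0 <= N%:R ^+ n * w.
      by rewrite mulr_ge0 ?(ltW N0)//; apply: le_trans mw; exact: ler0n.
    by move/eqP : jw; rewrite /digits truncn_eq// mulrC.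
  move=> /andP[jw wj].
  have w0 : 0 <= w.
    by rewrite -(pmulr_lge0 _ N0); apply: le_trans jw; exact: ler0n.
  split.
    apply/eqP; rewrite /digits truncn_eq; last by rewrite mulr_ge0// ltW.
    by rewrite mulrC; apply/andP.
  rewrite -(ler_pM2r N0) -[w <= _](ler_pM2r N0) -natrX -!natrM.
  rewrite natrX; apply/andP; split.
    by apply: le_trans jw; rewrite ler_nat -jx leq_divM.
  apply: (le_trans (ltW wj)); rewrite ler_nat -jx.
  exact: ltn_ceil.
rewrite lebesgue_measure_itv/= lte_fin ltr_pM2r ?invr_gt0// ltS -EFinD.
by rewrite -mulrBl -natrB// subSnn mul1r.
Qed.

Let step_eq (x y : 'rV[int]_d) i : (i < 2 * d)%N -> y - x = unit_step d i ->
  step_prob R x y = ((2 * d)%:R)^-1.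
Proof. by move=> id yx; rewrite /step_prob yx enorm_unit_step// eqxx. Qed.

Let cyl (y : nat -> 'rV[int]_d) n : set (measurableTypeR R) :=
  [set w | forall k, (k <= n)%N -> S k w = y k] `&`
  [set w | digits d 0 w = choice.pickle (y 0%N)].

Let cylS y n : cyl y n.+1 = cyl y n `&` [set w | S n.+1 w = y n.+1].
Proof.
apply/seteqP; split => w /=.
  by move=> [h ?]; do ?split => //; [move=> k kn; apply: h; lia|exact: h].
move=> [[h ?] h1]; split => // k; rewrite leq_eqVlt => /predU1P[->//|].
exact: h.
Qed.

Let shiftK j i : (i < 2 * d)%N -> ((j * (2 * d) + i) %/ (2 * d))%N = j.
Proof. by move=> id; rewrite divnMDl ?(divn_small id) ?addn0//; lia. Qed.

Let cylP y n :
  (exists j, [/\ (j %/ (2 * d) ^ n)%N = choice.pickle (y 0%N),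
    \prod_(k < n) step_prob R (y k) (y k.+1) = ((2 * d)%:R ^+ n)^-1 &
    cyl y n = [set w | digits d n w = j]]) \/
  (\prod_(k < n) step_prob R (y k) (y k.+1) = 0 /\ cyl y n = set0).
Proof.
elim: n => [|n [[j [jm pj cj]]|[p0 c0]]].
- left; exists (choice.pickle (y 0%N)).
  rewrite expn0 divn1 big_ord0 expr0 invr1; split => //.
  apply/seteqP; split => w /= => [[]//|wy]; split => //.
  by move=> k; rewrite leqn0 => /eqP ->; rewrite /S/= wy choice.pickleK.
- rewrite cylS big_ord_recr/= pj.
  have [yy|yy] := eqVneq (enorm R (y n.+1 - y n)) 1; last first.
    right; rewrite /step_prob (negbTE yy) mulr0; split => //.
    rewrite -subset0 => w [[wy _]]; rewrite /S/= => wS; move/negP : yy; apply.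
    rewrite -wS -(wy n)// /S digits_div// addrC addKr enorm_unit_step//.
    by rewrite ltn_mod; lia.
  have [i id yi] := enorm1P yy.
  left; exists (j * (2 * d) + i)%N; rewrite (step_eq id yi); split.
  + by rewrite expnS divnMA shiftK.
  + by rewrite exprSr invfM mulrC.
  + rewrite cj; apply/seteqP; split => w /=.
      move=> [jw]; have : cyl y n w by rewrite cj.
      move=> [/(_ n (leqnn _)) + _].
      rewrite {1}/S jw /S/= digits_div// jw => -> /(congr1 (+%R (- y n))).
      rewrite addKr [in RHS]addrC yi => /unit_step_inj.
      rewrite ltn_mod => /(_ (leq_ltn_trans (leq0n _) id) id) <-.
      by rewrite [LHS](divn_eq _ (2 * d)) digits_div// jw.
    move=> wj; have jw : digits d n w = j.
      by rewrite -(digits_div n w hd) wj shiftK.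
    split => //; have : cyl y n w by rewrite cj.
    move=> [/(_ n (leqnn _)) + _]; rewrite /S/= jw digits_div// jw => ->.
    by rewrite wj modnMDl modn_small// -yi addrC subrK.
- by right; rewrite cylS big_ord_recr/= p0 mul0r c0 set0I.
Qed.

Let mS n y : measurable [set w | S n w = y].
Proof.
rewrite (_ : mkset _ = \bigcup_(j in [set j | digit_walk d n j = y])
    [set w | digits d n w = j]).
  by apply: bigcup_measurable => j _; exact: measurable_digits.
by apply/seteqP; split => w /=; [move=> h; exists (digits d n w)|
  move=> [j /= <- <-]].
Qed.

Let walkP x : simple_random_walk (P x) S x.
Proof.
split => // n y; set A := [set w | _].
have mA : measurable A.
  rewrite (_ : A = \bigcap_(k in [set k | (k <= n)%N])
      [set w | S k w = y k]) //.
  by apply: bigcap_measurableType => k _; exact: mS.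
pose B := [set w : measurableTypeR R | digits d 0 w = choice.pickle x].
have mB : measurable B by exact: measurable_digits.
have PB : P x B = 1%E by rewrite P_digits ?expr0 ?invr1// expn0 divn1.
have -> : P x A = P x (A `&` B).
  rewrite -[in LHS](setDUK (@subIsetl _ A B)) measureU//; last 3 first.
  - exact: measurableI.
  - by apply: measurableD => //; exact: measurableI.
  - by rewrite setDIK.
  have PBC : P x (~` B) = 0%E by rewrite probability_setC// PB subee.
  rewrite [X in (_ + X)%E](_ : _ = 0%E) ?adde0//.
  apply/eqP; rewrite -measure_le0 -PBC le_measure ?inE//.
  - by apply: measurableD => //; exact: measurableI.
  - exact: measurableC.
  - by move=> w [Aw nAB] Bw; apply: nAB.
have [yx|yx] := eqVneq (y 0%N) x.
  rewrite mul1r; have -> : A `&` B = cyl y n by rewrite /cyl yx.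
  case: (cylP y n) => [[j [jm -> ->]]|[-> ->]]; last by rewrite measure0.
  by rewrite P_digits// -yx.
rewrite mul0r (_ : A `&` B = set0) ?measure0// -subset0 => w [/(_ 0%N)].
rewrite leq0n => /(_ isT) + wx; rewrite /S/= wx choice.pickleK/= => xy.
by rewrite xy eqxx in yx.
Qed.

Lemma simple_random_walk_exists :
  exists (disp : measure_display) (Omega : measurableType disp)
         (P : 'rV[int]_d -> probability Omega R)
         (S : nat -> Omega -> 'rV[int]_d),
    forall x, simple_random_walk (P x) S x.
Proof. by exists _, (measurableTypeR R), P, S. Qed.

End walk_existence.

(* Main.v *)
Require Import Defs.
From HB Require Import structures.
From mathcomp Require Import all_boot all_order all_algebra finmap.
From mathcomp Require Import all_classical all_reals all_analysis.
From mathcomp Require Import ring lra zify.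

(* Let eta(x) = (A / (|x|^2 + A))^((d-2)/2) be [bump A x], with A = a r^2 and a
   large constant a.  A Taylor expansion shows that eta minus its mean over the
   neighbours is comparable to A eta / (|x|^2 + A)^2, whose total mass over Z^d
   is of order r^(d-2) and which is at least of order r^(-2) on the ball of
   radius r.  Thus eta plays the role of the equilibrium potential of a ball of
   radius r, and no asymptotics of the Green function is needed.

   Choose W in C greedily, adding a point as long as the sum over W of the
   translates of eta is less than 1 there.  The potential of W is then at least
   1 on C, which bounds cap(B_r(C)) by a multiple of r^(d-2) |W|; and by
   symmetry of the kernel its energy is at most 3 |W|.  By Markov's inequality,
   at least half of the points of W have potential at most 6.  They form U:
   their potential is bounded on B_r(U), which bounds cap(B_r(U)) from below.

   Both capacity bounds pair the equilibrium charge e = v - mean(v), where v is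
   the hitting probability, with a superharmonic function, by Green's identity
   for the Green function truncated at a large time. *)

Import Order.TTheory GRing.Theory Num.Theory.
Import numFieldNormedType.Exports.

Local Open Scope classical_set_scope.
Local Open Scope ring_scope.

Set Implicit Arguments.
Unset Strict Implicit.

(** * Taylor expansion of (1 + t)^(-n/2) *)

Lemma inv_sqrt_taylor (R : realType) (t : R) : `|t| <= 2^-1 ->
  `|(Num.sqrt (1 + t))^-1 - (1 - t / 2 + 3 / 8 * t ^+ 2 - 5 / 16 * t ^+ 3)|
    <= 4 * t ^+ 4.
Proof.
rewrite ler_norml => /andP[tl tu].
have t1 : 0 < 1 + t by lra.
have t2 : t ^+ 2 <= 4^-1 by nra.
have t20 : 0 <= t ^+ 2 by exact: sqr_ge0.
set w := _^-1; set p := 1 - _ + _ - _.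
have w0 : 0 < w by rewrite invr_gt0 sqrtr_gt0.
have w2 : w ^+ 2 * (1 + t) = 1.
  by rewrite exprVn sqr_sqrtr ?mulVf ?ltW// lt0r_neq0.
have p0 : 2^-1 <= p by rewrite /p; nra.
pose s : R := - (35 / 64) + 14 / 64 * t - 35 / 256 * t ^+ 2 + 25 / 256 * t ^+ 3.
have wp : (w - p) * ((w + p) * (1 + t)) = - (t ^+ 4 * s).
  have -> : (w - p) * ((w + p) * (1 + t)) =
            w ^+ 2 * (1 + t) - p ^+ 2 * (1 + t) by ring.
  by rewrite w2 /p /s; field.
have s1 : `|s| <= 1 by rewrite ler_norml /s; apply/andP; split; nra.
have h : 4^-1 <= (w + p) * (1 + t) by nra.
have t4 : 0 <= t ^+ 4 by rewrite -[4%N]/(2 * 2)%N exprM sqr_ge0.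
have := congr1 Num.norm wp.
rewrite normrN [LHS]normrM [RHS]normrM (ger0_norm t4) [X in _ * X = _]ger0_norm.
  have := normr_ge0 (w - p).
  move: `|w - p| `|s| s1 => u v v1 u0 e.
  have : u * 4^-1 <= t ^+ 4.
    by apply: (@le_trans _ _ (u * ((w + p) * (1 + t)))); [nra|rewrite e; nra].
  by lra.
by lra.
Qed.

Lemma inv_sqrt_pow_taylor (R : realType) (n : nat) :
  exists c C : R, 0 <= C /\ forall t : R, `|t| <= 2^-1 ->
  `|(Num.sqrt (1 + t))^-1 ^+ n
    - (1 - n%:R / 2 * t + n%:R * (n%:R + 2) / 8 * t ^+ 2 + c * t ^+ 3)|
    <= C * t ^+ 4.
Proof.
elim: n => [|n [c [C [C0 IH]]]].
  exists 0, 0; split=> // t _; rewrite expr0 !mul0r subr0 !addr0 subrr normr0.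
  exact: lexx.
set N : R := n%:R in IH *; pose a := N / 2; pose b := N * (N + 2) / 8.
have N0 : 0 <= N by exact: ler0n.
pose c' := c - 5 / 16 - 3 / 8 * a - b / 2.
pose D1 := 5 / 16 * a + 3 / 8 * b - c / 2.
pose D2 := 3 / 8 * c - 5 / 16 * b.
pose D3 := - (5 / 16 * c).
pose B := 1 + `|a| + `|b| + `|c|.
exists c', (`|D1| + `|D2| + `|D3| + 2 * C + B * 4); split.
  by rewrite !addr_ge0// !mulr_ge0// !addr_ge0.
move=> t th; have := IH t th; have := inv_sqrt_taylor th.
rewrite -/a -/b.
set w := _^-1; set p := 1 - _ + _ - _; set pn := 1 - _ + _ + _ => E1 E.
have [tl tu] : - 2^-1 <= t /\ t <= 2^-1.
  by move: th; rewrite ler_norml => /andP.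
have t20 : 0 <= t ^+ 2 by exact: sqr_ge0.
have t2 : t ^+ 2 <= 4^-1 by nra.
have t40 : 0 <= t ^+ 4 by rewrite -[4%N]/(2 * 2)%N exprM sqr_ge0.
have t4 : t ^+ 4 <= 16^-1.
  by rewrite (_ : t ^+ 4 = t ^+ 2 * t ^+ 2); [nra|ring].
have -> : w ^+ n.+1 - (1 - n.+1%:R / 2 * t +
    n.+1%:R * (n.+1%:R + 2) / 8 * t ^+ 2 + c' * t ^+ 3) =
  t ^+ 4 * (D1 + D2 * t + D3 * t ^+ 2) + (w ^+ n - pn) * w + pn * (w - p).
  rewrite -natr1 -/N exprSr /pn /p /c' /D1 /D2 /D3 /a /b.
  by field.
have wb : `|w| <= 2.
  have : `|p| <= 3 / 2.
    by rewrite ler_norml /p; apply/andP; split; nra.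
  move=> pb; rewrite -(subrK p w); apply: le_trans (ler_normD _ _) _.
  by lra.
have pnb : `|pn| <= B.
  rewrite /pn /B; apply: le_trans (ler_normD _ _) _; apply: lerD.
    apply: le_trans (ler_normD _ _) _; apply: lerD.
      apply: le_trans (ler_normD _ _) _; rewrite normr1 normrN lerD2l normrM.
      by rewrite ler_piMr//; lra.
    by rewrite normrM ler_piMr// ger0_norm//; lra.
  by rewrite normrM ler_piMr// normrX exprn_ile1//; lra.
clearbody w p pn B D1 D2 D3.
have -> : (`|D1| + `|D2| + `|D3| + 2 * C + B * 4) * t ^+ 4 =
  t ^+ 4 * (`|D1| + `|D2| + `|D3|) + C * t ^+ 4 * 2 + B * (4 * t ^+ 4) by ring.
apply: le_trans (ler_normD _ _) _; apply: lerD; last first.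
  by rewrite normrM; apply: ler_pM.
apply: le_trans (ler_normD _ _) _; apply: lerD; last first.
  by rewrite normrM; apply: ler_pM.
rewrite normrM (ger0_norm t40); apply: ler_wpM2l => //.
apply: le_trans (ler_normD _ _) _; apply: lerD.
  apply: le_trans (ler_normD _ _) _; apply: lerD => //.
  by rewrite normrM ler_piMr//; lra.
by rewrite normrM ler_piMr// ger0_norm//; lra.
Qed.

(** * Walk means of the bump function *)

Definition sqnorm (R : realType) (d : nat) (x : 'rV[int]_d) : R :=
  \sum_(i < d) (x ord0 i)%:~R ^+ 2.

Definition walk_mean (R : realType) (d : nat) (f : 'rV[int]_d -> R)
    (x : 'rV[int]_d) : R :=
  (\sum_(i < 2 * d) f (x + unit_step d i)) / (2 * d)%:R.

Definition bump (R : realType) (d : nat) (A : R) (x : 'rV[int]_d) : R :=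
  Num.sqrt (A / (sqnorm R x + A)) ^+ (d - 2).

Lemma sqnorm_ge0 (R : realType) (d : nat) (x : 'rV[int]_d) : 0 <= sqnorm R x.
Proof. by apply: sumr_ge0 => i _; exact: sqr_ge0. Qed.

Lemma sqnormN (R : realType) (d : nat) (x : 'rV[int]_d) :
  sqnorm R (- x) = sqnorm R x.
Proof. by apply: eq_bigr => i _; rewrite mxE rmorphN sqrrN. Qed.

Lemma sqnorm0 (R : realType) (d : nat) : sqnorm R (0 : 'rV[int]_d) = 0.
Proof. by apply: big1 => i _; rewrite mxE expr0n. Qed.

Lemma sqnormD_le (R : realType) (d : nat) (x y : 'rV[int]_d) :
  sqnorm R (x + y) <= 2 * sqnorm R x + 2 * sqnorm R y.
Proof.
rewrite /sqnorm !mulr_sumr -big_split/=; apply: ler_sum => i _.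
rewrite mxE rmorphD/=; move: _%:~R _%:~R => a b.
by have := sqr_ge0 (a - b); nra.
Qed.

Lemma sqr_coord_le (R : realType) (d : nat) (x : 'rV[int]_d) (j : 'I_d) :
  (x ord0 j)%:~R ^+ 2 <= sqnorm R x.
Proof.
rewrite /sqnorm (bigD1 j)//= lerDl.
by apply: sumr_ge0 => i _; exact: sqr_ge0.
Qed.

Lemma big_unit_step (V : zmodType) (d : nat) (F : 'rV[int]_d -> V) :
  \sum_(i < 2 * d) F (unit_step d i) =
  \sum_(j < d) (F (delta_mx ord0 j) + F (- delta_mx ord0 j)).
Proof.
rewrite (_ : (2 * d)%N = (d + d)%N); last by rewrite mul2n addnn.
rewrite big_split_ord/= big_split/=; congr (_ + _); apply: eq_bigr => j _.
  congr F; apply/rowP => k; rewrite !mxE eqxx/= -val_eqE/=.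
  by have := ltn_ord j; lia.
congr F; apply/rowP => k; rewrite !mxE eqxx/= -val_eqE/=.
by have := ltn_ord k; lia.
Qed.

Lemma walk_meanE (R : realType) (d : nat) (f : 'rV[int]_d -> R) x :
  walk_mean f x = (\sum_(j < d) (f (x + delta_mx ord0 j) +
                                 f (x - delta_mx ord0 j))) / (2 * d)%:R.
Proof. by rewrite /walk_mean (big_unit_step (fun u => f (x + u))). Qed.

Lemma sqnormD_delta (R : realType) (d : nat) (x : 'rV[int]_d) (j : 'I_d)
    (s : int) : s ^+ 2 = 1 ->
  sqnorm R (x + s *: delta_mx ord0 j) =
  sqnorm R x + 1 + 2 * s%:~R * (x ord0 j)%:~R.
Proof.
move=> s2; rewrite /sqnorm (bigD1 j)//= [in RHS](bigD1 j)//= !mxE !eqxx mulr1.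
rewrite (eq_bigr (fun i => (x ord0 i)%:~R ^+ 2)); last first.
  by move=> i ij; rewrite !mxE (negbTE ij) andbF mulr0 addr0.
have : (s%:~R : R) ^+ 2 = 1 by rewrite -rmorphXn s2.
by rewrite rmorphD/=; move: _%:~R _%:~R (\sum_(_ < _ | _) _) => a b c; lra.
Qed.

Lemma bump_shift (R : realType) (d : nat) (A : R) (x y : 'rV[int]_d) (t : R) :
  0 < A -> - 1 < t ->
  sqnorm R y + A = (sqnorm R x + A) * (1 + t) ->
  bump A y = bump A x * (Num.sqrt (1 + t))^-1 ^+ (d - 2).
Proof.
move=> A0 t1 e; have := sqnorm_ge0 R x => x0.
rewrite /bump e -exprMn; congr (_ ^+ _).
rewrite invfM mulrA sqrtrM ?sqrtrV//; first by lra.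
by rewrite divr_ge0//; lra.
Qed.

Lemma bump_ge0 (R : realType) (d : nat) (A : R) (x : 'rV[int]_d) :
  0 <= bump A x.
Proof. by apply: exprn_ge0; exact: sqrtr_ge0. Qed.

Lemma walk_mean_bump (R : realType) (d : nat) : (2 <= d)%N ->
  exists C : R, 0 <= C /\ forall (A : R) (x : 'rV[int]_d), 40 <= A ->
  `|walk_mean (bump A) x -
     bump A x * (1 - (d - 2)%:R / 2 * (A / (sqnorm R x + A) ^+ 2))|
   <= bump A x * (C / (sqnorm R x + A) ^+ 2).
Proof.
move=> d2; set n := (d - 2)%N.
have [c [C [C0 jet]]] := inv_sqrt_pow_taylor R n.
have dn : d%:R = n%:R + 2 :> R by rewrite -natrD; congr _%:R; lia.
set N : R := n%:R in jet dn *.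
have N0 : 0 <= N by exact: ler0n.
have D0 : 0 < (2 * d)%:R :> R by rewrite ltr0n; lia.
have DE : (2 * d)%:R = 2 * (N + 2) :> R by rewrite natrM dn.
exists (C * 100 + N * (N + 2) / 8 + `|c| * 13); split.
  by rewrite !addr_ge0// ?mulr_ge0//; lra.
move=> A x A40; set q := sqnorm R x + A.
have x0 := sqnorm_ge0 R x; have q40 : 40 <= q by rewrite /q; lra.
pose P (t : R) := 1 - N / 2 * t + N * (N + 2) / 8 * t ^+ 2 + c * t ^+ 3.
pose T (s : R) j := (1 + 2 * s * (x ord0 j)%:~R) / q.
have T2 s j : s ^+ 2 = 1 -> T s j ^+ 2 <= 10 / q.
  move=> s2; rewrite /T exprMn exprVn expr2 invfM mulrA ler_wpM2r//.
    by rewrite invr_ge0; lra.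
  rewrite ler_pdivrMr; last by lra.
  have := sqr_coord_le R x j; move: _%:~R => b bx.
  have := sqr_ge0 (1 - 2 * s * b); rewrite /q !sqrrD.
  by rewrite !expr2 in s2 bx *; nra.
have T1 s j : s ^+ 2 = 1 -> `|T s j| <= 2^-1.
  move=> s2; have h := T2 s j s2.
  rewrite -(ler_pXn2r (n := 2))// ?nnegrE//.
  rewrite real_normK ?num_real//; apply: le_trans h _.
  by rewrite ler_pdivrMr; lra.
have T4 s j : s ^+ 2 = 1 -> T s j ^+ 4 <= 100 / q ^+ 2.
  move=> s2; have h := T2 s j s2.
  rewrite -[4%N]/(2 * 2)%N exprM (_ : 100 / q ^+ 2 = (10 / q) ^+ 2).
    by apply: lerXn2r => //; rewrite nnegrE ?sqr_ge0// divr_ge0//; lra.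
  by field; rewrite lt0r_neq0//; lra.
have step (s : int) j : s ^+ 2 = 1 ->
    `|bump A (x + s *: delta_mx ord0 j) - bump A x * P (T s%:~R j)|
      <= bump A x * (C * (100 / q ^+ 2)).
  move=> s2.
  have s2R : (s%:~R : R) ^+ 2 = 1 by rewrite -rmorphXn s2.
  have Ts := T1 s%:~R j s2R.
  rewrite (bump_shift (x := x) (t := T s%:~R j)); first last.
  - rewrite sqnormD_delta// /T -/q.
    by rewrite /q; field; rewrite lt0r_neq0//; lra.
  - by move: Ts; rewrite ler_norml; lra.
  - by lra.
  rewrite -mulrBr normrM (ger0_norm (bump_ge0 _ _)).
  apply: ler_wpM2l; first exact: bump_ge0.
  apply: le_trans (jet _ Ts) _; apply: ler_wpM2l => //; exact: T4.
have sumP : \sum_(j < d) (P (T 1 j) + P (T (-1) j)) =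
    (2 * d)%:R * (1 - N / 2 * (A / q ^+ 2)) +
    (2 * (N + 2) * (N * (N + 2) / 8) +
       c * (2 * (N + 2) + 24 * sqnorm R x) / q) / q ^+ 2.
  rewrite (eq_bigr (fun j => 2 - N / q + N * (N + 2) / 8 * 2 / q ^+ 2 +
     c * 2 / q ^+ 3 + (N * (N + 2) / q ^+ 2 + c * 24 / q ^+ 3) *
     (x ord0 j)%:~R ^+ 2)); last first.
    by move=> j _; rewrite /P /T; field; rewrite lt0r_neq0//; lra.
  rewrite big_split/= -mulr_sumr -/(sqnorm R x) sumr_const card_ord.
  rewrite -[_ *+ d]mulr_natr DE dn.
  have -> : sqnorm R x = q - A by rewrite /q addrK.
  by field; rewrite lt0r_neq0//; lra.
have -> : walk_mean (bump A) x - bump A x * (1 - N / 2 * (A / q ^+ 2)) =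
    (\sum_(j < d)
       ((bump A (x + delta_mx ord0 j) - bump A x * P (T 1 j)) +
        (bump A (x - delta_mx ord0 j) - bump A x * P (T (-1) j))) +
     bump A x * ((2 * (N + 2) * (N * (N + 2) / 8) +
       c * (2 * (N + 2) + 24 * sqnorm R x) / q) / q ^+ 2)) / (2 * d)%:R.
  rewrite walk_meanE [in RHS](eq_bigr (fun j => (bump A (x + delta_mx ord0 j) +
     bump A (x - delta_mx ord0 j)) - bump A x * (P (T 1 j) + P (T (-1) j))));
     last by move=> j _; ring.
  rewrite sumrB -mulr_sumr sumP; move: (\sum_(_ < _) _) => Sg.
  by rewrite DE; field; rewrite !lt0r_neq0//; lra.
rewrite normrM normfV (ger0_norm (ltW D0)) ler_pdivrMr//.
apply: le_trans (ler_normD _ _) _.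
have -> : bump A x * ((C * 100 + N * (N + 2) / 8 + `|c| * 13) / q ^+ 2) *
    (2 * d)%:R = bump A x * (C * (100 / q ^+ 2)) * (2 * d)%:R +
    bump A x * ((2 * (N + 2) * (N * (N + 2) / 8) + `|c| * (26 * (N + 2)))
       / q ^+ 2).
  by rewrite DE; field; rewrite !lt0r_neq0//; lra.
apply: lerD.
  apply: le_trans (ler_norm_sum _ _ _) _.
  have -> : bump A x * (C * (100 / q ^+ 2)) * (2 * d)%:R =
     \sum_(j < d) (bump A x * (C * (100 / q ^+ 2)) +
                   bump A x * (C * (100 / q ^+ 2))).
    by rewrite sumr_const card_ord -[_ *+ d]mulr_natr natrM; ring.
  apply: ler_sum => j _; apply: le_trans (ler_normD _ _) _.
  apply: lerD; first by have := step 1 j; rewrite scale1r; apply; exact: expr1n.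
  have := step (-1) j; rewrite scaleN1r rmorphN1; apply.
  by rewrite sqrrN expr1n.
rewrite normrM (ger0_norm (bump_ge0 _ _)); apply: ler_wpM2l.
  exact: bump_ge0.
rewrite normrM normfV (@ger0_norm _ (q ^+ 2)) ?sqr_ge0//.
apply: ler_wpM2r; first by rewrite invr_ge0 sqr_ge0.
apply: le_trans (ler_normD _ _) _; apply: lerD.
  by rewrite ger0_norm// !mulr_ge0//; lra.
rewrite -mulrA normrM; apply: ler_wpM2l => //.
rewrite ger0_norm; last by rewrite divr_ge0//; lra.
by rewrite ler_pdivrMr; [rewrite /q; nra|lra].
Qed.

Lemma walk_meanB (R : realType) (d : nat) (f g : 'rV[int]_d -> R) :
  walk_mean (f \- g) = walk_mean f \- walk_mean g.
Proof. by apply/funext => x; rewrite /walk_mean sumrB mulrBl. Qed.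

Lemma walk_mean_sum (R : realType) (d : nat) (I : Type) (s : seq I)
    (f : I -> 'rV[int]_d -> R) x :
  walk_mean (fun y => \sum_(i <- s) f i y) x = \sum_(i <- s) walk_mean (f i) x.
Proof. by rewrite /walk_mean exchange_big/= mulr_suml. Qed.

Lemma walk_mean_affine (R : realType) (d : nat) (a b : R)
    (f : 'rV[int]_d -> R) x : (0 < d)%N ->
  walk_mean (fun y => a + b * f y) x = a + b * walk_mean f x.
Proof.
move=> d0; rewrite /walk_mean big_split/= -mulr_sumr sumr_const card_ord.
have D0 : (2 * d)%:R != 0 :> R by rewrite pnatr_eq0; lia.
by rewrite -[_ *+ _]mulr_natr mulrDl mulfK// mulrA.
Qed.

Lemma ler_walk_mean (R : realType) (d : nat) (f g : 'rV[int]_d -> R) :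
  (forall x, f x <= g x) -> forall x, walk_mean f x <= walk_mean g x.
Proof.
move=> fg x; rewrite ler_wpM2r ?invr_ge0//; apply: ler_sum => i _; exact: fg.
Qed.

Lemma walk_mean_shift (R : realType) (d : nat) (f : 'rV[int]_d -> R) y :
  walk_mean (fun x => f (x - y)) = (fun x => walk_mean f (x - y)).
Proof.
apply/funext => x; rewrite /walk_mean; congr (_ / _).
by apply: eq_bigr => i _; rewrite addrAC.
Qed.

Lemma iter_meanB (R : realType) (d N : nat) (f g : 'rV[int]_d -> R) :
  iter N (@walk_mean R d) (f \- g) =
  iter N (@walk_mean R d) f \- iter N (@walk_mean R d) g.
Proof. by elim: N => //= N ->; exact: walk_meanB. Qed.

Lemma iter_mean_sum (R : realType) (d N : nat) (I : Type) (s : seq I)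
    (f : I -> 'rV[int]_d -> R) :
  iter N (@walk_mean R d) (fun y => \sum_(i <- s) f i y) =
  (fun x => \sum_(i <- s) iter N (@walk_mean R d) (f i) x).
Proof.
elim: N => //= N ->; apply/funext => x; exact: walk_mean_sum.
Qed.

Lemma iter_mean_affine (R : realType) (d N : nat) (a b : R)
    (f : 'rV[int]_d -> R) : (0 < d)%N ->
  iter N (@walk_mean R d) (fun y => a + b * f y) =
  (fun x => a + b * iter N (@walk_mean R d) f x).
Proof.
by move=> d0; elim: N => //= N ->; apply/funext => x; exact: walk_mean_affine.
Qed.

Lemma ler_iter_mean (R : realType) (d N : nat) (f g : 'rV[int]_d -> R) :
  (forall x, f x <= g x) ->
  forall x, iter N (@walk_mean R d) f x <= iter N (@walk_mean R d) g x.
Proof. by move=> fg; elim: N => //= N; exact: ler_walk_mean. Qed.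

Lemma iter_mean_shift (R : realType) (d N : nat) (f : 'rV[int]_d -> R) y :
  iter N (@walk_mean R d) (fun x => f (x - y)) =
  (fun x => iter N (@walk_mean R d) f (x - y)).
Proof. by elim: N => //= N ->; exact: walk_mean_shift. Qed.

Lemma iter_mean_ge0 (R : realType) (d N : nat) (f : 'rV[int]_d -> R) :
  (forall x, 0 <= f x) -> forall x, 0 <= iter N (@walk_mean R d) f x.
Proof.
move=> f0; elim: N => //= N IH x; rewrite mulr_ge0 ?invr_ge0//.
by apply: sumr_ge0.
Qed.

Lemma sum_iter_mean (R : realType) (d N : nat) (f : 'rV[int]_d -> R) x :
  \sum_(k < N) iter k (@walk_mean R d) (f \- walk_mean f) x =
  f x - iter N (@walk_mean R d) f x.
Proof.
elim: N => [|N IH]; first by rewrite big_ord0 subrr.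
by rewrite big_ord_recr/= IH iter_meanB/= -iterSr addrA subrK.
Qed.

Lemma iter_mean_nonincr (R : realType) (d : nat) (f : 'rV[int]_d -> R) :
  (forall x, walk_mean f x <= f x) -> forall k N x, (k <= N)%N ->
  iter N (@walk_mean R d) f x <= iter k (@walk_mean R d) f x.
Proof.
move=> sf k N x /subnK <-; elim: (N - k)%N => // m IH.
apply: le_trans IH; rewrite addSn iterSr.
exact: ler_iter_mean.
Qed.

(* The means of a superharmonic f along the walk are nonincreasing, so for such
   f this says that they tend to 0. *)
Definition vanishing (R : realType) (d : nat) (f : 'rV[int]_d -> R) : Prop :=
  forall x e, 0 < e -> exists N, iter N (@walk_mean R d) f x <= e.

(* The means of [f - walk_mean f] along the walk are summable, hence small at
   some time; there they control the mean of [f] itself up to e. *)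
Lemma vanishing_of_drift (R : realType) (d : nat) (f : 'rV[int]_d -> R) :
  (0 < d)%N -> (forall x, 0 <= f x) -> (forall x, walk_mean f x <= f x) ->
  (forall e, 0 < e -> exists2 C, 0 < C &
     forall x, f x <= e + C * (f x - walk_mean f x)) ->
  vanishing f.
Proof.
move=> d0 f0 sf fe x e e0.
have e20 : 0 < e / 2 by rewrite divr_gt0.
have [C C0 fC] := fe _ e20.
pose N := (Num.truncn (f x * C / (e / 2))).+1.
exists N; rewrite leNgt; apply/negP => lt_e.
have large k : (k < N)%N ->
    e / 2 / C <= iter k (@walk_mean R d) (f \- walk_mean f) x.
  move=> kN; rewrite ler_pdivrMr//.
  have := iter_mean_nonincr sf x (ltnW kN).
  have := ler_iter_mean k fC x.
  by rewrite iter_mean_affine// => h1 h2; rewrite mulrC; lra.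
have : \sum_(k < N) (e / 2 / C) <= f x.
  have -> : f x = (f x - iter N (@walk_mean R d) f x)
                  + iter N (@walk_mean R d) f x by rewrite subrK.
  rewrite -sum_iter_mean -[leLHS]addr0; apply: lerD; last exact: iter_mean_ge0.
  by apply: ler_sum => k _; apply: large.
rewrite sumr_const card_ord -[_ *+ _]mulr_natl mulrA ler_pdivrMr//.
rewrite -ler_pdivlMr// leNgt => /negP; apply; exact: truncnS_gt.
Qed.

Lemma bump_mean_bounds (R : realType) (d : nat) : (3 <= d)%N ->
  exists2 a : R, 40 <= a & forall (A : R) (x : 'rV[int]_d), a <= A ->
    4^-1 * (bump A x * (A / (sqnorm R x + A) ^+ 2))
      <= bump A x - walk_mean (bump A) x /\
    bump A x - walk_mean (bump A) x <=
      (d - 2)%:R * (bump A x * (A / (sqnorm R x + A) ^+ 2)).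
Proof.
move=> d3; have d2 : (2 <= d)%N by lia.
have [C [C0 h]] := walk_mean_bump R d2.
exists (40 + 4 * C); first by lra.
move=> A x aA; have A40 : 40 <= A by lra.
have := h A x A40.
set N : R := (d - 2)%:R.
have N1 : 1 <= N by rewrite ler1n; lia.
have x0 := sqnorm_ge0 R x.
have q0 : 0 < (sqnorm R x + A) ^+ 2 by rewrite exprn_gt0//; lra.
have b0 := bump_ge0 A x.
move: q0; set Q := _ ^+ 2; rewrite -invr_gt0 => q0.
rewrite ler_norml => /andP[].
set b := bump A x in b0 *; set m := walk_mean _ x.
have b1 : 0 <= b * Q^-1 by rewrite mulr_ge0// ltW.
move: b1; move: (Q^-1) => iQ b1 h1 h2.
have h3 : b * (C * iQ) <= A / 4 * (b * iQ) by nra.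
have h4 : A * (b * iQ) * 1 <= A * (b * iQ) * N.
  by apply: ler_wpM2l => //; rewrite mulr_ge0//; lra.
by split; nra.
Qed.

Lemma bump0 (R : realType) (d : nat) (A : R) : 0 < A ->
  bump A (0 : 'rV[int]_d) = 1.
Proof.
by move=> A0; rewrite /bump sqnorm0 add0r divff ?sqrtr1 ?expr1n// lt0r_neq0.
Qed.

Lemma bumpN (R : realType) (d : nat) (A : R) (x : 'rV[int]_d) :
  bump A (- x) = bump A x.
Proof. by rewrite /bump sqnormN. Qed.

Lemma bump_compare (R : realType) (d : nat) (A : R) (x y : 'rV[int]_d) :
  0 < A -> sqnorm R y + A <= 4 * (sqnorm R x + A) ->
  bump A x <= 2 ^+ (d - 2) * bump A y.
Proof.
move=> A0 h; have x0 := sqnorm_ge0 R x; have y0 := sqnorm_ge0 R y.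
rewrite /bump -exprMn; apply: lerXn2r; rewrite ?nnegrE ?mulr_ge0//.
rewrite (_ : 2 = Num.sqrt (2 ^+ 2) :> R); last first.
  by rewrite sqrtr_sqr ger0_norm.
rewrite -sqrtrM ?sqr_ge0//; apply: ler_wsqrtr.
rewrite mulrA ler_pdivrMr; last by lra.
rewrite mulrAC ler_pdivlMr; last by lra.
by nra.
Qed.

Lemma bumpD_compare (R : realType) (d : nat) (A : R) (x z : 'rV[int]_d) :
  0 < A -> sqnorm R z <= A ->
  bump A x <= 2 ^+ (d - 2) * bump A (x + z).
Proof.
move=> A0 zA; apply: bump_compare => //.
have h := sqnormD_le R x z; have x0 := sqnorm_ge0 R x.
lra.
Qed.

Lemma bump_superharmonic (R : realType) (d : nat) (A : R) : 0 < A ->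
  (forall x : 'rV[int]_d, 4^-1 * (bump A x * (A / (sqnorm R x + A) ^+ 2))
      <= bump A x - walk_mean (bump A) x) ->
  forall x : 'rV[int]_d, walk_mean (bump A) x <= bump A x.
Proof.
move=> A0 low x; rewrite -subr_ge0; apply: le_trans (low x).
have := sqnorm_ge0 R x => x0.
by rewrite !mulr_ge0 ?bump_ge0 ?invr_ge0 ?exprn_ge0//; lra.
Qed.

Lemma bump_vanishing (R : realType) (d : nat) (A : R) : (3 <= d)%N ->
  0 < A ->
  (forall x : 'rV[int]_d, 4^-1 * (bump A x * (A / (sqnorm R x + A) ^+ 2))
      <= bump A x - walk_mean (bump A) x) ->
  vanishing (@bump R d A).
Proof.
move=> d3 A0 low; apply: vanishing_of_drift; first by lia.
- exact: bump_ge0.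
- exact: bump_superharmonic.
move=> e e0; exists (4 * A / e ^+ 4).
  by rewrite divr_gt0 ?exprn_gt0//; lra.
move=> x; have := low x; set D := _ - _ => {}low.
have e4 : 0 < e ^+ 4 by rewrite exprn_gt0.
have x0 := sqnorm_ge0 R x; set q := sqnorm R x + A in low.
have q0 : 0 < q by rewrite /q; lra.
have b0 := bump_ge0 A x.
have D0 : 0 <= D.
  by apply: le_trans low; rewrite !mulr_ge0 ?invr_ge0 ?exprn_ge0//; lra.
have [be|eb] := leP (bump A x) e.
  rewrite -[leLHS]addr0; apply: lerD => //.
  by rewrite mulr_ge0 ?divr_ge0//; lra.
have h : e <= Num.sqrt (A / q).
  apply: le_trans (ltW eb) _; rewrite /bump -/q; apply: ler_iXnr => //.
    by lia.
  rewrite -sqrtr1 ler_wsqrtr// ler_pdivrMr// /q; lra.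
have h2 : e ^+ 2 <= A / q.
  rewrite -(@sqr_sqrtr _ (A / q)); last by rewrite divr_ge0//; lra.
  by apply: lerXn2r => //; rewrite nnegrE ?sqrtr_ge0 ?ltW.
have h4 : e ^+ 4 <= A ^+ 2 / q ^+ 2.
  rewrite -[4%N]/(2 * 2)%N exprM -expr_div_n.
  by apply: lerXn2r => //; rewrite nnegrE ?sqr_ge0// divr_ge0//; lra.
apply: (@le_trans _ _ (4 * A / e ^+ 4 * D)); last by rewrite lerDr ltW.
rewrite mulrAC ler_pdivlMr//.
apply: (@le_trans _ _ (bump A x * (A ^+ 2 / q ^+ 2))).
  by rewrite ler_wpM2l.
have -> : bump A x * (A ^+ 2 / q ^+ 2) =
   4 * A * (4^-1 * (bump A x * (A / q ^+ 2))).
  by field; rewrite lt0r_neq0.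
by rewrite ler_pM2l//; lra.
Qed.

(** * Lattice points in balls and the total drift *)

Lemma card_box_le (d m : nat) (s : seq 'rV[int]_d) : uniq s ->
  (forall x, x \in s -> forall i, `|x ord0 i| <= m%:Z) ->
  (size s <= (2 * m).+1 ^ d)%N.
Proof.
move=> us sm.
pose g (x : 'rV[int]_d) : {ffun 'I_d -> 'I_(2 * m).+1} :=
  [ffun i => inord (absz (x ord0 i + m%:Z))].
have gi : {in s &, injective g}.
  move=> x y xs ys /ffunP gxy; apply/rowP => i.
  have := gxy i; rewrite !ffunE => /(congr1 val)/=.
  have := sm x xs i; have := sm y ys i; rewrite !ler_norml.
  move: (x ord0 i) (y ord0 i) => a b /andP[? ?] /andP[? ?].
  by rewrite !inordK; lia.
have ug : uniq (map g s) by rewrite map_inj_in_uniq.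
have -> : ((2 * m).+1 ^ d)%N = #|{: {ffun 'I_d -> 'I_(2 * m).+1}}|.
  by rewrite card_ffun !card_ord.
rewrite -(size_map g) cardE; apply: uniq_leq_size => // y _.
by rewrite mem_enum.
Qed.

Lemma card_ball_le (R : realType) (d : nat) (M : R) (s : seq 'rV[int]_d) :
  0 <= M -> uniq s -> (forall x, x \in s -> sqnorm R x < M ^+ 2) ->
  (size s)%:R <= (2 * M + 1) ^+ d.
Proof.
move=> M0 us sM; have /andP[le_m lt_m] := truncn_itv M0.
apply: (@le_trans _ _ (((2 * Num.truncn M).+1 ^ d)%N%:R)).
  rewrite ler_nat; apply: card_box_le => // x xs i.
  rewrite -ltzD1 -(ltr_int R) addrC -intS.
  apply: lt_trans lt_m; rewrite intr_norm.
  have := le_lt_trans (sqr_coord_le R x i) (sM x xs).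
  rewrite -(@real_normK _ _%:~R) ?num_real//.
  by rewrite ltr_pXn2r ?nnegrE.
rewrite natrX; apply: lerXn2r; rewrite ?nnegrE//; first by lra.
by rewrite -natr1 natrM; lra.
Qed.

Lemma ball_card_ge (R : realType) (d : nat) (r : R) : 1 <= r ->
  exists s : seq 'rV[int]_d,
    [/\ uniq s, forall x, x \in s -> sqnorm R x < r ^+ 2
      & (r / d.+1%:R) ^+ d <= (size s)%:R].
Proof.
move=> r1; set M := r / d.+1%:R.
have M0 : 0 <= M by rewrite divr_ge0//; lra.
have /andP[le_m lt_m] := truncn_itv M0.
set m := Num.truncn M in le_m lt_m.
pose g (f : {ffun 'I_d -> 'I_m.+1}) : 'rV[int]_d := \row_i (f i)%:Z.
have gi : injective g.
  move=> x y /rowP xy; apply/ffunP => i; apply: val_inj.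
  by have := xy i; rewrite !mxE => -[].
exists (map g (enum {: {ffun 'I_d -> 'I_m.+1}})); split.
- by rewrite map_inj_uniq ?enum_uniq.
- move=> x /mapP[f _ ->].
  apply: (@le_lt_trans _ _ (d%:R * M ^+ 2)).
    have -> : d%:R * M ^+ 2 = \sum_(i < d) M ^+ 2.
      by rewrite sumr_const card_ord mulr_natl.
    apply: ler_sum => i _; rewrite mxE; apply: lerXn2r; rewrite ?nnegrE//.
    by apply: le_trans le_m; rewrite ler_nat -ltnS.
  rewrite /M expr_div_n mulrA ltr_pdivrMr ?exprn_gt0// mulrC.
  rewrite ltr_pM2l ?exprn_gt0//; last by lra.
  rewrite -natrX ltr_nat expnS expn1.
  by nia.
- rewrite size_map -cardE card_ffun !card_ord natrX.
  by apply: lerXn2r; rewrite ?nnegrE// ltW.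
Qed.

Lemma dyadic_shell (R : realType) (L rho : R) : 0 < L -> L <= rho ->
  exists k : nat, 2 ^+ k * L <= rho < 2 ^+ k.+1 * L.
Proof.
move=> L0 Lr.
have ex : exists k, rho < 2 ^+ k.+1 * L.
  exists (Num.truncn (rho / L)); rewrite -ltr_pdivrMr//.
  have := truncnS_gt (rho / L); move=> /lt_le_trans; apply.
  by rewrite -natrX ler_nat ltnW// ltn_expl.
case: (ex_minnP ex) => k hk kmin; exists k; rewrite hk andbT.
case: k hk kmin => [|k] hk kmin; first by rewrite expr0 mul1r.
by rewrite leNgt; apply/negP => /kmin; rewrite ltnn.
Qed.

Lemma geometric_quarter_le (R : realType) (K : nat) :
  \sum_(k < K) (4^-1 : R) ^+ k <= 2.
Proof.
suff -> : \sum_(k < K) (4^-1 : R) ^+ k = 4 / 3 * (1 - 4^-1 ^+ K).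
  have : 0 <= (4^-1 : R) ^+ K by rewrite exprn_ge0.
  by lra.
elim: K => [|K IH]; first by rewrite big_ord0 expr0 subrr mulr0.
by rewrite big_ord_recr/= IH exprS; lra.
Qed.

Lemma bump_drift_sum (R : realType) (d : nat) (A : R) (s : seq 'rV[int]_d) :
  (2 <= d)%N -> 1 <= A -> uniq s ->
  \sum_(x <- s) bump A x * (A / (sqnorm R x + A) ^+ 2)
    <= 2 * 5 ^+ d * Num.sqrt A ^+ (d - 2).
Proof.
move=> d2 A1 us; set L := Num.sqrt A.
have A0 : 0 < A by lra.
have L1 : 1 <= L by rewrite -sqrtr1 ler_wsqrtr.
have L2 : L ^+ 2 = A by rewrite sqr_sqrtr ?ltW.
have L0 : 0 < L by lra.
pose rho (x : 'rV[int]_d) : R := Num.sqrt (sqnorm R x + A).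
have rL x : L <= rho x.
  by rewrite ler_wsqrtr// lerDr sqnorm_ge0.
have r2 x : rho x ^+ 2 = sqnorm R x + A.
  by rewrite sqr_sqrtr// addr_ge0 ?sqnorm_ge0// ltW.
have [kap kapP] := choice (fun x => dyadic_shell L0 (rL x)).
pose a k := L ^+ (d - 2) * ((4^-1) ^+ k / (2 ^+ k * L) ^+ d).
have term x : bump A x * (A / (sqnorm R x + A) ^+ 2) <= a (kap x).
  have /andP[lo _] := kapP x; set k := kap x in lo *.
  have p0 : 0 < 2 ^+ k * L by rewrite mulr_gt0// exprn_gt0.
  have rx0 : 0 < rho x by apply: lt_le_trans lo.
  rewrite /bump -r2 sqrtrM ?(ltW A0)// -/L sqrtrV ?sqr_ge0//.
  rewrite sqrtr_sqr (ger0_norm (ltW rx0)).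
  rewrite exprMn -mulrA /a; apply: ler_wpM2l; first by rewrite exprn_ge0 ?ltW.
  have -> : (rho x)^-1 ^+ (d - 2) * (A / rho x ^+ 2 ^+ 2) =
            L ^+ 2 * (rho x)^-1 ^+ (d + 2).
    rewrite (_ : (d + 2 = d - 2 + 4)%N); last by lia.
    by rewrite exprD L2 mulrCA -exprM -exprVn.
  have -> : (4^-1) ^+ k / (2 ^+ k * L) ^+ d =
            L ^+ 2 * (2 ^+ k * L)^-1 ^+ (d + 2).
    have -> : (4^-1 : R) ^+ k = (2 ^+ k)^-1 ^+ 2.
      by rewrite -exprVn -exprM mulnC exprM; congr (_ ^+ _); field.
    rewrite exprD (exprVn _ d); set c := 2 ^+ k; set D := (_ ^+ d)^-1.
    have c0 : 0 < c by rewrite exprn_gt0.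
    by clearbody D; field; rewrite !lt0r_neq0.
  apply: ler_wpM2l; first exact: sqr_ge0.
  by apply: lerXn2r; rewrite ?nnegrE ?lef_pV2 ?posrE// invr_ge0 ltW.
pose K := (\max_(x <- s) kap x).+1.
apply: (@le_trans _ _ (\sum_(x <- s) \sum_(k < K | kap x == k) a k)).
  rewrite big_seq [leRHS]big_seq; apply: ler_sum => x xs.
  have kK : (kap x < K)%N by rewrite ltnS; apply: leq_bigmax_seq.
  by rewrite (big_pred1 (Ordinal kK)).
rewrite (exchange_big_dep xpredT)//=.
apply: (@le_trans _ _ (\sum_(k < K) 5 ^+ d * L ^+ (d - 2) * (4^-1) ^+ k)).
  apply: ler_sum => k _; set p := 2 ^+ k * L.
  have p1 : 1 <= p.
    by rewrite -[leLHS]mul1r; apply: ler_pM => //; rewrite exprn_ege1// ler1n.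
  rewrite big_const_seq iter_addr_0 -[_ *+ _]mulr_natl -size_filter.
  rewrite /a -/p.
  rewrite [leLHS](_ : _ = L ^+ (d - 2) * 4^-1 ^+ k *
     ((size [seq x <- s | kap x == k])%:R / p ^+ d)); last by ring.
  rewrite [leRHS](_ : _ = L ^+ (d - 2) * 4^-1 ^+ k * 5 ^+ d); last by ring.
  apply: ler_wpM2l; first by rewrite mulr_ge0// exprn_ge0// ltW.
  rewrite ler_pdivrMr ?exprn_gt0//; last by lra.
  apply: (@le_trans _ _ ((2 * (2 * p) + 1) ^+ d)).
    apply: card_ball_le; [by lra|by rewrite filter_uniq|].
    move=> x; rewrite mem_filter => /andP[/eqP kx _].
    have /andP[_ up] := kapP x; rewrite kx in up.
    apply: (@lt_trans _ _ (rho x ^+ 2)); first by rewrite r2; lra.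
    rewrite ltr_pXn2r ?nnegrE//; last by lra.
      by rewrite mulrA -exprS.
    exact: sqrtr_ge0.
  by rewrite -exprMn; apply: lerXn2r; rewrite ?nnegrE//; lra.
rewrite -mulr_sumr mulrC -mulrA; apply: ler_pM => //.
- by apply: sumr_ge0 => k _; rewrite exprn_ge0.
- by rewrite mulr_ge0// exprn_ge0// ltW.
exact: geometric_quarter_le.
Qed.

(** * Charges and Green's identity *)

Lemma iter_mean_scale (R : realType) (d N : nat) (b : R)
    (f : 'rV[int]_d -> R) :
  iter N (@walk_mean R d) (fun y => b * f y) =
  (fun x => b * iter N (@walk_mean R d) f x).
Proof.
elim: N => //= N ->; apply/funext => x.
by rewrite /walk_mean -mulr_sumr mulrA.
Qed.

Definition finitely_supported (R : realType) (d : nat)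
    (g : 'rV[int]_d -> R) : Prop :=
  exists A : {fset 'rV[int]_d}, forall x, x \notin A -> g x = 0.

Definition dot (R : realType) (d : nat) (g f : 'rV[int]_d -> R) : R :=
  \sum_(x \in [set: 'rV[int]_d]) g x * f x.

Lemma dotE (R : realType) (d : nat) (A : {fset 'rV[int]_d})
    (g f : 'rV[int]_d -> R) : (forall x, x \notin A -> g x = 0) ->
  dot g f = \sum_(x <- A) g x * f x.
Proof. by move=> gA; apply: fsbigTE => x xA; rewrite gA// mul0r. Qed.

Lemma finitely_supportedD (R : realType) (d : nat) (g h : 'rV[int]_d -> R) :
  finitely_supported g -> finitely_supported h ->
  finitely_supported (fun x => g x + h x).
Proof.
move=> [A gA] [B hB]; exists ((A `|` B)%fset) => x.
by rewrite inE negb_or => /andP[/gA -> /hB ->]; rewrite addr0.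
Qed.

Lemma dotDl (R : realType) (d : nat) (g h f : 'rV[int]_d -> R) :
  finitely_supported g -> finitely_supported h ->
  dot (fun x => g x + h x) f = dot g f + dot h f.
Proof.
move=> [A gA] [B hB].
have gU x : x \notin (A `|` B)%fset -> g x = 0.
  by rewrite inE negb_or => /andP[/gA].
have hU x : x \notin (A `|` B)%fset -> h x = 0.
  by rewrite inE negb_or => /andP[_ /hB].
rewrite (dotE _ gU) (dotE _ hU) (@dotE _ _ ((A `|` B)%fset)); last first.
  by move=> x xU; rewrite gU// hU// addr0.
by rewrite -big_split/=; apply: eq_bigr => x _; rewrite mulrDl.
Qed.

Lemma dotDr (R : realType) (d : nat) (g f h : 'rV[int]_d -> R) :
  finitely_supported g ->
  dot g (fun x => f x + h x) = dot g f + dot g h.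
Proof.
move=> [A gA]; rewrite !(dotE _ gA) -big_split/=.
by apply: eq_bigr => x _; rewrite mulrDr.
Qed.

Lemma finitely_supported_mean (R : realType) (d : nat) (g : 'rV[int]_d -> R) :
  finitely_supported g -> finitely_supported (walk_mean g).
Proof.
move=> [A gA]; pose B := [fset p.1 - unit_step d p.2 |
  p in [seq (x, nat_of_ord i) | x <- A, i <- enum 'I_(2 * d)]]%fset.
exists B => x xB; rewrite /walk_mean big1 ?mul0r// => i _; apply: gA.
apply: contra xB => xA; apply/imfsetP; exists (x + unit_step d i, i : nat).
  by apply: allpairs_f => //; rewrite mem_enum.
by rewrite /= addrK.
Qed.

Lemma dot_shift (R : realType) (d : nat) (g f : 'rV[int]_d -> R) u :
  dot g (fun x => f (x + u)) = dot (fun x => g (x - u)) f.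
Proof.
rewrite /dot (reindex_fsbigT (fun x => x - u)).
  by apply: eq_fsbigr => x _; rewrite subrK.
by exists (fun x => x + u) => x; rewrite ?subrK ?addrK.
Qed.

Lemma dot_sumr (R : realType) (d : nat) (I : Type) (s : seq I)
    (g : 'rV[int]_d -> R) (f : I -> 'rV[int]_d -> R) : finitely_supported g ->
  dot g (fun x => \sum_(i <- s) f i x) = \sum_(i <- s) dot g (f i).
Proof.
move=> [A gA]; rewrite (dotE _ gA).
rewrite (eq_bigr (fun i => \sum_(x <- A) g x * f i x)); last first.
  by move=> i _; exact: dotE.
by rewrite exchange_big/=; apply: eq_bigr => x _; rewrite mulr_sumr.
Qed.

Lemma dot_suml (R : realType) (d : nat) (I : Type) (s : seq I)
    (g : I -> 'rV[int]_d -> R) (f : 'rV[int]_d -> R) :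
  (forall i, finitely_supported (g i)) ->
  finitely_supported (fun x => \sum_(i <- s) g i x) /\
  dot (fun x => \sum_(i <- s) g i x) f = \sum_(i <- s) dot (g i) f.
Proof.
move=> gs; elim: s => [|i s [IHs IHd]].
  split; first by exists fset0 => x _; rewrite big_nil.
  rewrite big_nil (@dotE _ _ fset0) ?big_seq_fset0//.
  by move=> x _; rewrite big_nil.
have -> : (fun x => \sum_(j <- i :: s) g j x) =
          (fun x => g i x + \sum_(j <- s) g j x).
  by apply/funext => x; rewrite big_cons.
split; first exact: finitely_supportedD.
by rewrite dotDl// IHd big_cons.
Qed.

Lemma dot_scale (R : realType) (d : nat) (g f : 'rV[int]_d -> R) (c : R) :
  finitely_supported g ->
  dot g (fun x => f x / c) = dot g f / c /\
  dot (fun x => g x / c) f = dot g f / c.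
Proof.
move=> [A gA].
have gcA x : x \notin A -> g x / c = 0 by move=> /gA ->; rewrite mul0r.
rewrite !(dotE _ gA) (dotE _ gcA) !mulr_suml.
by split; apply: eq_bigr => x _; rewrite ?mulrA// mulrAC.
Qed.

Lemma dot_mean (R : realType) (d : nat) (g f : 'rV[int]_d -> R) :
  finitely_supported g -> dot g (walk_mean f) = dot (walk_mean g) f.
Proof.
move=> gs.
have shift u : finitely_supported (fun x => g (x + u)).
  case: gs => A gA; exists [fset x - u | x in A]%fset => x xA; apply: gA.
  by apply: contra xA => xA; apply/imfsetP; exists (x + u) => //; rewrite addrK.
rewrite /walk_mean (dot_scale _ _ gs).1 dot_sumr//.
have [s1 ->] : finitely_supported
    (fun x => \sum_(i < 2 * d) g (x + unit_step d i)) /\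
    dot (fun x => (\sum_(i < 2 * d) g (x + unit_step d i)) / (2 * d)%:R) f =
    dot (fun x => \sum_(i < 2 * d) g (x + unit_step d i)) f / (2 * d)%:R.
  have [s1 _] := dot_suml (index_enum 'I_(2 * d)) f
                          (fun i : 'I_(2 * d) => shift (unit_step d i)).
  by split => //; rewrite (dot_scale f _ s1).2.
congr (_ / _).
rewrite (dot_suml _ f (fun i : 'I_(2 * d) => shift (unit_step d i))).2.
rewrite (big_unit_step (fun u => dot g (fun x => f (x + u)))).
rewrite (big_unit_step (fun u => dot (fun x => g (x + u)) f)).
apply: eq_bigr => j _; rewrite !dot_shift addrC; congr (_ + _).
by congr dot; apply/funext => x; rewrite opprK.
Qed.

Lemma finitely_supported_iter (R : realType) (d N : nat)
    (g : 'rV[int]_d -> R) : finitely_supported g ->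
  finitely_supported (iter N (@walk_mean R d) g).
Proof. by move=> gs; elim: N => //= N; exact: finitely_supported_mean. Qed.

Lemma dot_iter_mean (R : realType) (d N : nat) (g f : 'rV[int]_d -> R) :
  finitely_supported g ->
  dot g (iter N (@walk_mean R d) f) = dot (iter N (@walk_mean R d) g) f.
Proof.
elim: N g => //= N IH g gs.
rewrite dot_mean// IH; last exact: finitely_supported_mean.
by rewrite -iterS iterSr.
Qed.

(* Green's identity for the Green function truncated at time N. *)
Lemma dot_green (R : realType) (d N : nat) (v f : 'rV[int]_d -> R) :
  finitely_supported (v \- walk_mean v) ->
  finitely_supported (v \- iter N (@walk_mean R d) v) /\
  dot (v \- walk_mean v) (f \- iter N (@walk_mean R d) f) =
  dot (v \- iter N (@walk_mean R d) v) (f \- walk_mean f).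
Proof.
move=> es.
have E (g : 'rV[int]_d -> R) : g \- iter N (@walk_mean R d) g =
    fun x => \sum_(k < N) iter k (@walk_mean R d) (g \- walk_mean g) x.
  by apply/funext => x; rewrite sum_iter_mean.
rewrite !E.
have [s ->] := dot_suml (index_enum 'I_N) (f \- walk_mean f)
  (fun k : 'I_N => finitely_supported_iter k es).
split=> //; rewrite dot_sumr//.
by apply: eq_bigr => k _; rewrite dot_iter_mean.
Qed.

Lemma vanishing_uniform (R : realType) (d : nat) (f : 'rV[int]_d -> R)
    (s : seq 'rV[int]_d) (e : R) : (forall x, walk_mean f x <= f x) ->
  vanishing f -> 0 < e ->
  exists N, forall x, x \in s -> iter N (@walk_mean R d) f x <= e.
Proof.
move=> sf vf e0; elim: s => [|y s [N IH]]; first by exists 0%N.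
have [k hk] := vf y e e0; exists (maxn k N) => x.
rewrite inE => /predU1P[->|xs].
  by apply: le_trans hk; apply: iter_mean_nonincr => //; exact: leq_maxl.
by apply: le_trans (IH x xs); apply: iter_mean_nonincr => //; exact: leq_maxr.
Qed.

Lemma ler_addgt0_mul (R : realType) (a b c : R) : 0 <= c ->
  (forall e, 0 < e -> a <= b + e * c) -> a <= b.
Proof.
move=> c0 h; rewrite leNgt; apply/negP => ba.
have c1 : 0 < c + 1 by lra.
have := h ((a - b) / (c + 1)); rewrite divr_gt0 ?subr_gt0// => /(_ isT).
rewrite -lerBlDl mulrAC ler_pdivlMr// leNgt => /negP; apply.
by nra.
Qed.

Lemma charge_le (R : realType) (d : nat) (F : {fset 'rV[int]_d})
    (v phi : 'rV[int]_d -> R) (M : R) :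
  (forall x, 0 <= v x <= 1) ->
  (forall x, walk_mean v x <= v x) ->
  (forall x, x \notin F -> walk_mean v x = v x) ->
  (forall x, 0 <= phi x) -> (forall x, walk_mean phi x <= phi x) ->
  vanishing phi -> (forall x, x \in F -> 1 <= phi x) ->
  (forall s : seq 'rV[int]_d, uniq s ->
     \sum_(x <- s) (phi x - walk_mean phi x) <= M) ->
  \sum_(x <- F) (v x - walk_mean v x) <= M.
Proof.
move=> v01 sv hv phi0 sphi vphi phi1 phiM.
have eF x : x \notin F -> (v \- walk_mean v) x = 0.
  by move=> xF /=; rewrite hv ?subrr.
have e0 x : 0 <= v x - walk_mean v x by rewrite subr_ge0.
apply: (@ler_addgt0_mul _ _ _ (\sum_(x <- F) (v x - walk_mean v x))).
  by apply: sumr_ge0.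
move=> e ep; have [N hN] := vanishing_uniform F sphi vphi ep.
have [[A wA] E] := dot_green N phi (ex_intro _ F eF).
apply: (@le_trans _ _ (dot (v \- walk_mean v) phi)).
  rewrite (dotE _ eF) big_seq [leRHS]big_seq; apply: ler_sum => x xF.
  by rewrite /= ler_peMr// phi1.
have -> : phi = fun x => (phi \- iter N (@walk_mean R d) phi) x +
                         iter N (@walk_mean R d) phi x.
  by apply/funext => x /=; rewrite subrK.
rewrite dotDr; last by exists F.
apply: lerD.
  rewrite [leLHS]E (dotE _ wA).
  apply: le_trans (phiM A (fset_uniq A)); apply: ler_sum => x _.
  rewrite ler_piMl ?subr_ge0//=.
  have : 0 <= iter N (@walk_mean R d) v x.
    by apply: iter_mean_ge0 => y; case/andP: (v01 y).
  by case/andP: (v01 x); lra.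
rewrite (dotE _ eF) mulr_sumr big_seq [leRHS]big_seq; apply: ler_sum => x xF.
by rewrite mulrC; apply: ler_wpM2r; [exact: e0|exact: hN].
Qed.

Lemma charge_ge (R : realType) (d : nat) (F : {fset 'rV[int]_d})
    (v psi mu : 'rV[int]_d -> R) (B c : R) :
  (forall x, x \in F -> v x = 1) ->
  (forall x, walk_mean v x <= v x) ->
  (forall x, x \notin F -> walk_mean v x = v x) ->
  (forall x, 0 <= psi x) -> (forall x, walk_mean psi x <= psi x) ->
  vanishing psi -> (forall x, x \in F -> psi x <= B) ->
  0 <= c -> (forall x, v x <= c * psi x) ->
  (forall x, 0 <= mu x) -> (forall x, x \notin F -> mu x = 0) ->
  (forall x, mu x <= psi x - walk_mean psi x) ->
  \sum_(x <- F) mu x <= B * \sum_(x <- F) (v x - walk_mean v x).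
Proof.
move=> v1 sv hv psi0 spsi vpsi psiB c0 vpsic mu0 muF mupsi.
have eF x : x \notin F -> (v \- walk_mean v) x = 0.
  by move=> xF /=; rewrite hv ?subrr.
have e0 x : 0 <= v x - walk_mean v x by rewrite subr_ge0.
apply: (@ler_addgt0_mul _ _ _ (c * \sum_(x <- F) mu x)).
  by rewrite mulr_ge0//; apply: sumr_ge0.
move=> e ep; have [N hN] := vanishing_uniform F spsi vpsi ep.
have [[A wA] E] := dot_green N psi (ex_intro _ F eF).
have wU x : x \notin (A `|` F)%fset -> (v \- iter N (@walk_mean R d) v) x = 0.
  by rewrite inE negb_or => /andP[/wA].
have w0 x : 0 <= (v \- iter N (@walk_mean R d) v) x.
  by rewrite /= subr_ge0; exact: (iter_mean_nonincr sv x (leq0n N)).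
have up : dot (v \- walk_mean v) (psi \- iter N (@walk_mean R d) psi) <=
    B * \sum_(x <- F) (v x - walk_mean v x).
  rewrite (dotE _ eF) mulr_sumr big_seq [leRHS]big_seq; apply: ler_sum => x xF.
  rewrite mulrC; apply: ler_wpM2r => //=.
  have := psiB x xF; have := iter_mean_ge0 N psi0 x; lra.
have lo : \sum_(x <- F) mu x * (1 - c * e) <=
   dot (v \- iter N (@walk_mean R d) v) (psi \- walk_mean psi).
  rewrite (dotE _ wU).
  apply: (@le_trans _ _ (\sum_(x <- (A `|` F)%fset)
     (v \- iter N (@walk_mean R d) v) x * mu x)).
    rewrite -(dotE mu wU) /dot (fsbigTE F); last first.
      by move=> x /muF ->; rewrite mulr0.
    rewrite big_seq [leRHS]big_seq; apply: ler_sum => x xF /=.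
    rewrite mulrC; apply: ler_wpM2r; first exact: mu0.
    have : iter N (@walk_mean R d) v x <= c * e.
      have := ler_iter_mean N vpsic x.
      rewrite iter_mean_scale => /le_trans; apply.
      by rewrite ler_wpM2l// hN.
    by rewrite v1//; lra.
  by apply: ler_sum => x _; apply: ler_wpM2l.
move: lo; rewrite -mulr_suml -E => /le_trans /(_ up).
by move: (\sum_(_ <- _) _) (B * _) => m b; nra.
Qed.

(** * Hitting probabilities and escape probabilities *)

Fixpoint avoid (R : realType) (d : nat) (F : {fset 'rV[int]_d}) (N : nat)
    (x : 'rV[int]_d) : R :=
  if x \in F then 0 else if N is N'.+1 then walk_mean (avoid R F N') x else 1.

Lemma walk_mean_cst (R : realType) (d : nat) (a : R) (x : 'rV[int]_d) :
  (0 < d)%N -> walk_mean (fun=> a) x = a.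
Proof.
move=> d0; rewrite /walk_mean sumr_const card_ord -[_ *+ _]mulr_natr mulfK//.
by rewrite pnatr_eq0; lia.
Qed.

Lemma avoidS (R : realType) (d : nat) (F : {fset 'rV[int]_d}) (N : nat) x :
  avoid R F N.+1 x = if x \in F then 0 else walk_mean (avoid R F N) x.
Proof. by []. Qed.

Lemma avoid_itv (R : realType) (d : nat) (F : {fset 'rV[int]_d}) (N : nat) x :
  (0 < d)%N -> 0 <= avoid R F N x <= 1.
Proof.
move=> d0; elim: N x => [|N IH] x.
  by rewrite /=; case: ifP; rewrite ?lexx ?ler01.
rewrite avoidS; case: ifP => _; first by rewrite lexx ler01.
apply/andP; split; last first.
  rewrite -(walk_mean_cst 1 x d0); apply: ler_walk_mean => y.
  by case/andP: (IH y).
rewrite -(walk_mean_cst 0 x d0); apply: ler_walk_mean => y.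
by case/andP: (IH y).
Qed.

Lemma avoid_nonincr (R : realType) (d : nat) (F : {fset 'rV[int]_d}) (N : nat)
    x : (0 < d)%N -> avoid R F N.+1 x <= avoid R F N x.
Proof.
move=> d0; elim: N x => [|N IH] x.
  rewrite avoidS /=; case: ifP => // _.
  rewrite -[leRHS](walk_mean_cst 1 x d0); apply: ler_walk_mean => y.
  by case/andP: (avoid_itv R F 0 y d0).
by rewrite avoidS [leRHS]avoidS; case: ifP => // _; exact: ler_walk_mean.
Qed.

Lemma cvg_walk_mean (R : realType) (d : nat) (f : nat -> 'rV[int]_d -> R)
    (g : 'rV[int]_d -> R) :
  (forall x, f N x @[N --> \oo] --> g x) ->
  forall x, walk_mean (f N) x @[N --> \oo] --> walk_mean g x.
Proof.
move=> fg x; rewrite /walk_mean; apply: cvgMl; apply: cvg_big => [|i _].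
  exact: add_continuous.
exact: fg.
Qed.

Lemma hitting_potential (R : realType) (d : nat) (F : {fset 'rV[int]_d}) :
  (0 < d)%N -> exists v : 'rV[int]_d -> R,
  [/\ (forall x, 0 <= v x <= 1) /\ (forall x, x \in F -> v x = 1),
    forall x, walk_mean v x <= v x,
    forall x, x \notin F -> walk_mean v x = v x,
    forall s : 'rV[int]_d -> R, (forall x, 0 <= s x) ->
      (forall x, walk_mean s x <= s x) -> (forall x, x \in F -> 1 <= s x) ->
      forall x, v x <= s x
    & forall x, x \in F ->
      walk_mean (avoid R F N) x @[N --> \oo] --> v x - walk_mean v x].
Proof.
move=> d0; pose G x := limn (fun N => avoid R F N x).
have cG x : avoid R F N x @[N --> \oo] --> G x.
  apply: nonincreasing_is_cvgn.
    apply/nonincreasing_seqP => N; exact: avoid_nonincr.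
  by exists 0 => _ [N _ <-]; case/andP: (avoid_itv R F N x d0).
have cP := cvg_walk_mean cG.
have G01 x : 0 <= G x <= 1.
  apply/andP; split.
    apply: limr_ge; first exact: cG.
    by near=> N; case/andP: (avoid_itv R F N x d0).
  apply: limr_le; first exact: cG.
  by near=> N; case/andP: (avoid_itv R F N x d0).
have GS x : G x = if x \in F then 0 else walk_mean G x.
  have h1 : avoid R F N.+1 x @[N --> \oo] --> G x.
    by have := cG x; rewrite -(cvg_shiftS (fun N => avoid R F N x)).
  have h2 : avoid R F N.+1 x @[N --> \oo] -->
            (if x \in F then 0 else walk_mean G x).
    under eq_fun do rewrite avoidS.
    by case: ifP => _; [exact: cvg_cst|exact: cP].
  by rewrite -(cvg_lim (@norm_hausdorff _ _) h2) (cvg_lim _ h1).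
have Pv x : walk_mean (fun y => 1 - G y) x = 1 - walk_mean G x.
  have := walk_mean_affine 1 (-1) G x d0; rewrite mulN1r => <-.
  by congr walk_mean; apply/funext => y; rewrite mulN1r.
exists (fun x => 1 - G x); split.
- split=> [x|x xF]; first by case/andP: (G01 x); lra.
  by rewrite GS xF subr0.
- move=> x; rewrite Pv [in leRHS]GS; case: ifP => _ //.
  rewrite lerD2l lerN2 -(walk_mean_cst 0 x d0); apply: ler_walk_mean => y.
  by case/andP: (G01 y).
- by move=> x xF; rewrite Pv [in RHS]GS (negbTE xF).
- move=> s s0 ss s1 x.
  suff : 1 - s x <= G x by lra.
  apply: limr_ge; first exact: cG.
  near=> N; have : forall y, 1 - s y <= avoid R F N y; last by [].
  elim: {+}N => [|m IH] y.
    by rewrite /=; case: ifP => [/s1|]; have := s0 y; lra.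
  rewrite avoidS; case: ifP => [/s1|_]; first by lra.
  apply: (@le_trans _ _ (1 - walk_mean s y)); first by have := ss y; lra.
  rewrite -[leLHS](_ : walk_mean (fun z => 1 + -1 * s z) y = _).
    by apply: ler_walk_mean => z; rewrite mulN1r.
  by rewrite walk_mean_affine// mulN1r.
- move=> x xF; rewrite Pv [G x]GS xF.
  by rewrite (_ : 1 - 0 - _ = walk_mean G x); [exact: cP|lra].
Unshelve. all: by end_near. Qed.

Lemma measure_split_ord (R : realType) (disp : measure_display)
    (Omega : measurableType disp) (P : {measure set Omega -> \bar R})
    (K : nat) (D : set Omega) (B : 'I_K -> set Omega) :
  measurable D -> (forall i, measurable (B i)) -> trivIset setT B ->
  P D = (\sum_(i < K) P (D `&` B i) +
         P (D `\` \big[setU/set0]_(i < K) B i))%E.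
Proof.
move=> mD mB tB.
have mU : measurable (\big[setU/set0]_(i < K) B i).
  exact: bigsetU_measurable.
rewrite (measureDI P mD mU) addeC.
congr (_ + _)%E; rewrite -measure_bigsetU_ord.
- by rewrite big_distrr.
- by move=> i; apply: measurableI.
- move=> i j _ _ [w [[_ Bi] [_ Bj]]]; apply: tB => //; by exists w.
Qed.

(* [escape] concerns the times 1, ..., N, whereas [avoid] includes time 0. *)
Definition escape (R : realType) (d : nat) (F : {fset 'rV[int]_d}) (N : nat)
    (x : 'rV[int]_d) : R :=
  if N is N'.+1 then walk_mean (avoid R F N') x else 1.

Definition cylinder (d : nat) (Omega : Type) (S : nat -> Omega -> 'rV[int]_d)
    (y : nat -> 'rV[int]_d) (m : nat) : set Omega :=
  [set w | forall k, (k <= m)%N -> S k w = y k].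

Definition avoiding (d : nat) (Omega : Type) (S : nat -> Omega -> 'rV[int]_d)
    (F : {fset 'rV[int]_d}) (m n : nat) : set Omega :=
  [set w | forall k, (m < k <= n)%N -> S k w \notin F].

Lemma avoidE (R : realType) (d : nat) (F : {fset 'rV[int]_d}) (N : nat) x :
  avoid R F N x = if x \in F then 0 else escape R F N x.
Proof. by case: N. Qed.

Lemma measurable_cylinder (d : nat) (disp : measure_display)
    (Omega : measurableType disp) (S : nat -> Omega -> 'rV[int]_d) y m :
  (forall n z, measurable [set w | S n w = z]) ->
  measurable (cylinder S y m).
Proof.
move=> mS; rewrite (_ : cylinder S y m =
  \bigcap_(k in [set k | (k <= m)%N]) [set w | S k w = y k])//.
by apply: bigcap_measurableType => k _; exact: mS.
Qed.

Lemma measurable_avoiding (d : nat) (disp : measure_display)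
    (Omega : measurableType disp) (S : nat -> Omega -> 'rV[int]_d) F m n :
  (forall n z, measurable [set w | S n w = z]) ->
  measurable (avoiding S F m n).
Proof.
move=> mS; rewrite (_ : avoiding S F m n =
  \bigcap_(k in [set k | (m < k <= n)%N])
     ~` \bigcup_(z in [set` F]) [set w | S k w = z]).
  apply: bigcap_measurableType => k _; apply: measurableC.
  by apply: fin_bigcup_measurable => // z _; exact: mS.
apply/seteqP; split => w /= h k /= kmn.
  by move=> [z zF Sz]; have := h k kmn; rewrite Sz => /negP; apply.
by apply/negP => SF; apply: (h k kmn); exists (S k w).
Qed.

Definition extend_path (d : nat) (y : nat -> 'rV[int]_d) (m : nat)
    (z : 'rV[int]_d) (k : nat) : 'rV[int]_d := if (k <= m)%N then y k else z.

Lemma cylinder_extend (d : nat) (Omega : Type)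
    (S : nat -> Omega -> 'rV[int]_d) y m z :
  cylinder S (extend_path y m z) m.+1 =
  cylinder S y m `&` [set w | S m.+1 w = z].
Proof.
apply/seteqP; split => w.
  move=> h; split; last by have := h _ (leqnn _); rewrite /extend_path ltnn.
  by move=> k km; rewrite h /extend_path ?km// leqW.
move=> [h1 h2] k; rewrite leq_eqVlt /extend_path => /predU1P[->|].
  by rewrite ltnn.
by rewrite ltnS => km; rewrite km; apply: h1.
Qed.

Lemma step_prob_unit (R : realType) (d : nat) (x : 'rV[int]_d)
    (i : 'I_(2 * d)) :
  step_prob R x (x + unit_step d i) = (2 * d)%:R^-1.
Proof.
by rewrite /step_prob [x + _]addrC addrK enorm_unit_step ?eqxx// ltn_ord.
Qed.

Lemma walk_avoiding_prob (R : realType) (d : nat) (disp : measure_display)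
    (Omega : measurableType disp) (P : probability Omega R)
    (S : nat -> Omega -> 'rV[int]_d) (x : 'rV[int]_d)
    (F : {fset 'rV[int]_d}) (N : nat) :
  (0 < d)%N -> simple_random_walk P S x -> forall m y,
  P (cylinder S y m `&` avoiding S F m (m + N)) =
  ((y 0%N == x)%:R * \prod_(k < m) step_prob R (y k) (y k.+1) *
     escape R F N (y m))%:E.
Proof.
move=> d0 [mS Pcyl]; elim: N => [|N IH] m y.
  rewrite addn0 mulr1 -Pcyl; congr (P _); apply/seteqP.
  by split => w; [case|move=> h; split => // k; lia].
pose B (i : 'I_(2 * d)) := [set w | S m.+1 w = y m + unit_step d i].
have mB i : measurable (B i) by exact: mS.
have tB : trivIset setT B.
  move=> i j _ _ [w []]; rewrite /B/= => -> /addrI h; apply: val_inj.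
  by apply: (@unit_step_inj d) h; exact: ltn_ord.
have mA := measurable_avoiding F m (m + N.+1) mS.
have mC := measurable_cylinder y m mS.
set W := _ * \prod_(_ < m) _.
have D0 : (2 * d)%:R != 0 :> R by rewrite pnatr_eq0; lia.
have weight z :
  (extend_path y m z 0 == x)%:R * \prod_(k < m.+1)
     step_prob R (extend_path y m z k) (extend_path y m z k.+1)
  = W * step_prob R (y m) z.
  rewrite big_ord_recr/= mulrA; congr (_ * _ * _).
    apply: eq_bigr => k _; rewrite /extend_path.
    by rewrite (ltnW (ltn_ord k)) ltn_ord.
  by rewrite /extend_path leqnn ltnn.
have cylB i : P (cylinder S y m `&` B i) = (W / (2 * d)%:R)%:E.
  rewrite -cylinder_extend [P _]Pcyl weight.
  by rewrite step_prob_unit.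
have rest : P (cylinder S y m `\` \big[setU/set0]_(i < 2 * d) B i) = 0%E.
  have : (P (cylinder S y m) = \sum_(i < 2 * d) P (cylinder S y m `&` B i) +
      P (cylinder S y m `\` \big[setU/set0]_(i < 2 * d) B i))%E.
    exact: measure_split_ord.
  rewrite [P (cylinder _ _ _)]Pcyl -/W (eq_bigr _ (fun i _ => cylB i)).
  rewrite sumEFin sumr_const card_ord -[_ *+ _]mulr_natr mulfVK//.
  have : (0 <= P (cylinder S y m `\` \big[setU/set0]_(i < 2 * d) B i))%E by [].
  case: (P _) => [u| |]//= _ [/eqP]; rewrite -subr_eq0 opprD addrA subrr sub0r.
  by rewrite oppr_eq0 => /eqP ->.
pose D := cylinder S y m `&` avoiding S F m (m + N.+1).
have mD : measurable D by exact: measurableI.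
have -> : (P D = \sum_(i < 2 * d) P (D `&` B i) +
    P (D `\` \big[setU/set0]_(i < 2 * d) B i))%E.
  exact: measure_split_ord.
rewrite /D.
rewrite [X in (_ + X)%E](_ : _ = 0%E) ?adde0; last first.
  apply: subset_measure0 rest.
  - apply: measurableD; first exact: measurableI.
    exact: bigsetU_measurable.
  - by apply: measurableD => //; exact: bigsetU_measurable.
  - by apply: setSD; exact: subIsetl.
rewrite (eq_bigr (fun i : 'I_(2 * d) =>
  (W / (2 * d)%:R * avoid R F N (y m + unit_step d i))%:E)); last first.
  move=> i _; rewrite avoidE; case: ifPn => zF.
    rewrite mulr0 (_ : _ `&` _ = set0) ?measure0// -subset0 => w [[_ h]] /= Bw.
    have := h m.+1; rewrite Bw zF => /(_ _)/negP; apply => //.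
    by rewrite ltnSn addnS ltnS leq_addr.
  have := IH m.+1 (extend_path y m (y m + unit_step d i)).
  rewrite weight step_prob_unit [extend_path _ _ _ m.+1]/extend_path ltnn => <-.
  rewrite cylinder_extend; congr (P _); apply/seteqP; split => w.
    move=> [[c a] b]; split; first by split.
    by move=> k kmn; apply: (a k); lia.
  move=> [[c b] a]; do 2!split => //.
  move=> k /andP[mk kn]; have [->|km] := eqVneq k m.+1; first by rewrite b.
  by apply: (a k); lia.
rewrite sumEFin -mulr_sumr /=; congr EFin.
by rewrite /walk_mean; ring.
Qed.

Lemma escape_prob (R : realType) (d : nat) (disp : measure_display)
    (Omega : measurableType disp) (P : probability Omega R)
    (S : nat -> Omega -> 'rV[int]_d) (x : 'rV[int]_d)
    (F : {fset 'rV[int]_d}) (N : nat) :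
  (0 < d)%N -> simple_random_walk P S x ->
  P (avoiding S F 0 N) = (escape R F N x)%:E.
Proof.
move=> d0 PS; have [mS Pcyl] := PS.
have := walk_avoiding_prob F N d0 PS 0 (fun=> x).
rewrite eqxx big_ord0 !mul1r add0n => <-.
have mC := measurable_cylinder (fun=> x) 0 mS.
have mA := measurable_avoiding F 0 N mS.
have PC : P (cylinder S (fun=> x) 0) = 1%E.
  by rewrite [P _]Pcyl eqxx big_ord0 mul1r.
have PCc : P (~` cylinder S (fun=> x) 0) = 0%E.
  by rewrite probability_setC// PC subee.
rewrite (measureDI P mA mC) setIC [X in (X + _)%E](_ : _ = 0%E) ?add0e//.
apply: (@subset_measure0 _ _ _ _ _ (~` cylinder S (fun=> x) 0)).
- exact: measurableD.
- exact: measurableC.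
- by move=> w [].
- exact: PCc.
Qed.

Lemma no_return (R : realType) (d : nat) (Omega : Type)
    (S : nat -> Omega -> 'rV[int]_d) (F : {fset 'rV[int]_d}) :
  [set w | return_time R S [set` F] w = +oo%E] =
  \bigcap_N avoiding S F 0 N.
Proof.
apply/seteqP; split => w.
  move=> /= ret N _ k /andP[k0 _]; apply/negP => SF.
  have : (return_time R S [set` F] w <= (k%:R : R)%:E)%E.
    by apply: ereal_inf_lbound; exists k.
  by rewrite ret.
move=> av /=; rewrite /return_time.
rewrite [X in ereal_inf X](_ : _ = set0) ?ereal_inf0//.
rewrite -subset0 => _ [k /= [k0 SF] _].
by have := av k I k; rewrite k0 leqnn SF => /(_ isT).
Qed.

Lemma capE (R : realType) (d : nat) (disp : measure_display)
    (Omega : measurableType disp) (P : 'rV[int]_d -> probability Omega R)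
    (S : nat -> Omega -> 'rV[int]_d) (F : {fset 'rV[int]_d})
    (v : 'rV[int]_d -> R) :
  (0 < d)%N -> (forall x, simple_random_walk (P x) S x) ->
  (forall x, x \in F ->
      walk_mean (avoid R F N) x @[N --> \oo] --> v x - walk_mean v x) ->
  cap P S [set` F] = \sum_(x <- F) (v x - walk_mean v x).
Proof.
move=> d0 PS cv; rewrite /cap fsbig_finite//= set_fsetK.
rewrite big_seq [RHS]big_seq; apply: eq_bigr => x xF; rewrite no_return.
have [mS _] := PS x.
have cP : P x (avoiding S F 0 N.+1) @[N --> \oo] -->
    P x (\bigcap_N avoiding S F 0 N).
  rewrite (cvg_shiftS (fun N => P x (avoiding S F 0 N))).
  apply: nonincreasing_cvg_mu.
  - rewrite (le_lt_trans (probability_le1 _ _)) ?ltry//.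
    exact: measurable_avoiding.
  - by move=> N; exact: measurable_avoiding.
  - by apply: bigcapT_measurable => N; exact: measurable_avoiding.
  - apply/nonincreasing_seqP => N; apply/subsetPset => w av k /andP[k0 kN].
    by apply: (av k); rewrite k0 leqW.
have : P x (avoiding S F 0 N.+1) @[N --> \oo] --> (v x - walk_mean v x)%:E.
  under eq_cvg do rewrite (escape_prob _ _ d0 (PS x)).
  by apply: cvg_EFin; [exact: nearW|exact: cv].
by move=> /(cvg_unique (@ereal_hausdorff _) cP) ->.
Qed.

(** * The greedy subset *)

(* A point is added as long as its potential is less than 1, so that each
   addition increases the energy by at most 3. *)
Lemma greedy_subset (R : realType) (T : choiceType) (K : T -> T -> R)
    (C : {fset T}) :
  (forall x y, K x y = K y x) -> (forall x, K x x = 1) ->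
  (forall x y, 0 <= K x y) ->
  exists W : {fset T}, [/\ (W `<=` C)%fset,
    forall z, z \in C -> 1 <= \sum_(y <- W) K z y &
    \sum_(x <- W) \sum_(y <- W) K x y <= 3 * #|` W|%:R].
Proof.
move=> Ksym Kdiag K0.
suff : forall k (W : {fset T}), (W `<=` C)%fset ->
    \sum_(x <- W) \sum_(y <- W) K x y <= 3 * #|` W|%:R ->
    (#|` C| - #|` W| <= k)%N ->
    exists W : {fset T}, [/\ (W `<=` C)%fset,
      forall z, z \in C -> 1 <= \sum_(y <- W) K z y &
      \sum_(x <- W) \sum_(y <- W) K x y <= 3 * #|` W|%:R].
  move=> /(_ (#|` C| - #|` fset0 : {fset T}|)%N fset0); apply => //.
  by rewrite big_seq_fset0 mulr_ge0.
elim=> [|k IH] W WC EW Wk;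
  have [WP|] := pselect (forall z, z \in C -> 1 <= \sum_(y <- W) K z y);
  try (by exists W); move=> /existsNP[z /not_implyP[zC /negP]];
  rewrite -ltNge => Kz;
  (have zW : z \notin W by
    apply/negP => zW; move: Kz; rewrite (big_fsetD1 z)//= Kdiag ltNge => /negP;
    apply; rewrite lerDl; apply: sumr_ge0);
  (have WzC : (z |` W `<=` C)%fset by rewrite fsubUset fsub1set zC);
  have := fsubset_leq_card WzC; rewrite cardfsU1 zW /= => cW.
  by lia.
apply: (IH (z |` W)%fset) => //; last by rewrite cardfsU1 zW; lia.
rewrite cardfsU1 zW natrD mulrDr mulr1 big_fsetU1//= big_fsetU1//= Kdiag.
rewrite [X in _ + X <= _](eq_bigr (fun x => K z x + \sum_(y <- W) K x y));
  last first.
  by move=> x _; rewrite big_fsetU1//= Ksym.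
by rewrite big_split/=; lra.
Qed.

Definition potential (R : realType) (d : nat) (A : R) (U : {fset 'rV[int]_d})
    (z : 'rV[int]_d) : R := \sum_(x <- U) bump A (z - x).

Lemma potential_ge0 (R : realType) (d : nat) (A : R) (U : {fset 'rV[int]_d}) z :
  0 <= potential A U z.
Proof. by apply: sumr_ge0 => x _; exact: bump_ge0. Qed.

Lemma walk_mean_potential (R : realType) (d : nat) (A : R)
    (U : {fset 'rV[int]_d}) z :
  walk_mean (potential A U) z = \sum_(x <- U) walk_mean (bump A) (z - x).
Proof.
rewrite walk_mean_sum; apply: eq_bigr => x _.
by rewrite walk_mean_shift.
Qed.

Lemma potential_vanishing (R : realType) (d : nat) (A : R)
    (U : {fset 'rV[int]_d}) :
  (forall x : 'rV[int]_d, walk_mean (bump A) x <= bump A x) ->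
  vanishing (@bump R d A) -> vanishing (potential A U).
Proof.
move=> sb vb z e e0.
have e1 : 0 < e / (#|` U|%:R + 1) by rewrite divr_gt0// ltr_pwDr.
have [N hN] := vanishing_uniform [seq z - x | x <- U] sb vb e1.
exists N; rewrite iter_mean_sum.
apply: (@le_trans _ _ (\sum_(x <- U) e / (#|` U|%:R + 1))).
  rewrite big_seq [leRHS]big_seq; apply: ler_sum => x xU.
  by rewrite iter_mean_shift; apply: hN; exact: map_f.
rewrite big_const_seq count_predT iter_addr_0 -[_ *+ _]mulr_natr.
rewrite mulrAC ler_pdivrMr ?ltr_pwDr//; apply: ler_wpM2l; first exact: ltW.
by rewrite lerDl.
Qed.

Lemma vanishing_scale (R : realType) (d : nat) (c : R) (f : 'rV[int]_d -> R) :
  0 < c -> vanishing f -> vanishing (fun x => c * f x).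
Proof.
move=> c0 vf x e e0; have [N hN] := vf x _ (divr_gt0 e0 c0).
by exists N; rewrite iter_mean_scale mulrC -ler_pdivlMr.
Qed.

Lemma potential_compare (R : realType) (d : nat) (A : R)
    (U : {fset 'rV[int]_d}) (x w : 'rV[int]_d) : 0 < A -> sqnorm R w <= A ->
  potential A U x <= 2 ^+ (d - 2) * potential A U (x + w).
Proof.
move=> A0 wA; rewrite /potential mulr_sumr; apply: ler_sum => y _.
by rewrite [x + w - y]addrAC; exact: bumpD_compare.
Qed.

Lemma enorm_lt (R : realType) (d : nat) (r : R) (x : 'rV[int]_d) : 0 <= r ->
  (enorm R x < r) = (sqnorm R x < r ^+ 2).
Proof.
move=> r0; rewrite -(@ltr_pXn2r _ 2)// ?nnegrE ?sqrtr_ge0//.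
by rewrite sqr_sqrtr// sqnorm_ge0.
Qed.

Lemma mem_nbhd (R : realType) (d : nat) (r : R) (C : {fset 'rV[int]_d})
    (z : 'rV[int]_d) : 0 <= r ->
  reflect (exists2 x, x \in C & sqnorm R (z - x) < r ^+ 2)
    (z \in fset_set (lattice_nbhd r [set` C])).
Proof.
move=> r0; rewrite in_fset_set; last exact: finite_lattice_nbhd.
apply: (iffP idP); rewrite inE.
  by move=> [x xC]; rewrite /lattice_ball/= enorm_lt//; exists x.
by move=> [x xC zx]; exists x => //; rewrite /lattice_ball/= enorm_lt.
Qed.

Lemma cap_nbhd_le (R : realType) (d : nat) (a A : R) (disp : measure_display)
    (Omega : measurableType disp) (P : 'rV[int]_d -> probability Omega R)
    (S : nat -> Omega -> 'rV[int]_d) (r : R) (C U : {fset 'rV[int]_d}) :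
  (3 <= d)%N -> (forall x, simple_random_walk (P x) S x) ->
  1 <= r -> 1 <= a -> A = a * r ^+ 2 ->
  (forall x : 'rV[int]_d,
    4^-1 * (bump A x * (A / (sqnorm R x + A) ^+ 2))
      <= bump A x - walk_mean (bump A) x /\
    bump A x - walk_mean (bump A) x <=
      (d - 2)%:R * (bump A x * (A / (sqnorm R x + A) ^+ 2))) ->
  (forall x, x \in C -> 1 <= potential A U x) ->
  cap P S (lattice_nbhd r [set` C]) <=
    2 ^+ (d - 2) * ((d - 2)%:R * (2 * 5 ^+ d * Num.sqrt a ^+ (d - 2))) *
      (r ^+ (d - 2) * #|` U|%:R).
Proof.
move=> d3 PS r1 a1 AE drift CU.
have d0 : (0 < d)%N by lia.
have r0 : 0 <= r by lra.
have r2A : r ^+ 2 <= A by rewrite AE ler_peMl// sqr_ge0.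
have A1 : 1 <= A by apply: le_trans r2A; exact: exprn_ege1.
have A0 : 0 < A by lra.
have sb := bump_superharmonic A0 (fun x => (drift x).1).
have vb := bump_vanishing d3 A0 (fun x => (drift x).1).
set n := (d - 2)%N in drift *.
have c0 : 0 < (2 : R) ^+ n by rewrite exprn_gt0.
set L := lattice_nbhd r [set` C].
have fL : finite_set L by exact: finite_lattice_nbhd.
rewrite -[L](fset_setK fL); set F := fset_set L.
have [v [[v01 v1] sv hv vmin cv]] := hitting_potential R F d0.
rewrite (capE d0 PS cv).
have mE x : walk_mean (fun z => 2 ^+ n * potential A U z) x =
            2 ^+ n * walk_mean (potential A U) x.
  by have := iter_mean_scale 1 (2 ^+ n) (potential A U) => /= ->.
have spot x : walk_mean (potential A U) x <= potential A U x.
  by rewrite walk_mean_potential; apply: ler_sum => y _; exact: sb.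
apply: (@charge_le _ _ F v (fun z => 2 ^+ n * potential A U z)) => //.
- by move=> x; rewrite mulr_ge0 ?potential_ge0// ltW.
- by move=> x; rewrite mE ler_pM2l.
- by apply: vanishing_scale => //; exact: potential_vanishing.
- move=> z /mem_nbhd[//|x xC zx]; apply: le_trans (CU x xC) _.
  rewrite -[in leRHS](subrK x z) [in leRHS]addrC.
  apply: potential_compare => //.
  by apply: le_trans (ltW zx) _.
move=> s us.
rewrite (eq_bigr (fun z => 2 ^+ n * \sum_(x <- U)
    (bump A (z - x) - walk_mean (bump A) (z - x)))); last first.
  by move=> z _; rewrite mE walk_mean_potential -mulrBr sumrB.
rewrite -mulr_sumr -mulrA ler_pM2l// exchange_big/=.
apply: (@le_trans _ _ (\sum_(x <- U)
    n%:R * (2 * 5 ^+ d * Num.sqrt A ^+ n))).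
  apply: ler_sum => x _.
  apply: (@le_trans _ _ (n%:R * \sum_(y <- [seq z - x | z <- s])
      (bump A y * (A / (sqnorm R y + A) ^+ 2)))).
    rewrite big_map mulr_sumr; apply: ler_sum => z _; exact: (drift (z - x)).2.
  apply: ler_wpM2l => //; apply: bump_drift_sum => //; first by lia.
  by rewrite map_inj_uniq//; exact: addIr.
rewrite big_const_seq count_predT iter_addr_0 -[_ *+ _]mulr_natr.
rewrite AE sqrtrM; last by lra.
rewrite sqrtr_sqr ger0_norm// exprMn.
by rewrite le_eqVlt; apply/orP; left; apply/eqP; ring.
Qed.

Lemma cap_nbhd_ge (R : realType) (d : nat) (a A : R) (disp : measure_display)
    (Omega : measurableType disp) (P : 'rV[int]_d -> probability Omega R)
    (S : nat -> Omega -> 'rV[int]_d) (r : R) (U : {fset 'rV[int]_d}) :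
  (3 <= d)%N -> (forall x, simple_random_walk (P x) S x) ->
  1 <= r -> 1 <= a -> A = a * r ^+ 2 ->
  (forall x : 'rV[int]_d,
    4^-1 * (bump A x * (A / (sqnorm R x + A) ^+ 2))
      <= bump A x - walk_mean (bump A) x) ->
  (forall x, x \in U -> potential A U x <= 6) ->
  r ^+ (d - 2) * #|` U|%:R <=
    6 * 2 ^+ (d - 2) * (16 * 2 ^+ (d - 2) * a * d.+1%:R ^+ d) *
      cap P S (lattice_nbhd r [set` U]).
Proof.
move=> d3 PS r1 a1 AE drift U6.
have d0 : (0 < d)%N by lia.
have r0 : 0 <= r by lra.
have r2A : r ^+ 2 <= A by rewrite AE ler_peMl// sqr_ge0.
have A1 : 1 <= A by apply: le_trans r2A; exact: exprn_ege1.
have A0 : 0 < A by lra.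
have sb := bump_superharmonic A0 drift.
have vb := bump_vanishing d3 A0 drift.
set n := (d - 2)%N in drift *.
have c0 : 0 < (2 : R) ^+ n by rewrite exprn_gt0.
set L := lattice_nbhd r [set` U].
have fL : finite_set L by exact: finite_lattice_nbhd.
rewrite -[L](fset_setK fL); set F := fset_set L.
have [v [[v01 v1] sv hv vmin cv]] := hitting_potential R F d0.
rewrite (capE d0 PS cv).
have mE x : walk_mean (fun z => 2 ^+ n * potential A U z) x =
            2 ^+ n * walk_mean (potential A U) x.
  by have := iter_mean_scale 1 (2 ^+ n) (potential A U) => /= ->.
have spot x : walk_mean (potential A U) x <= potential A U x.
  by rewrite walk_mean_potential; apply: ler_sum => y _; exact: sb.
have near1 (w : 'rV[int]_d) : sqnorm R w < r ^+ 2 -> 1 <= 2 ^+ n * bump A w.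
  move=> wr; have := @bumpD_compare R d A 0 w A0.
  by rewrite add0r bump0//; apply; apply: le_trans r2A; exact: ltW.
pose kappa : R := (16 * 2 ^+ n * A)^-1.
have kappa0 : 0 < kappa by rewrite invr_gt0 !mulr_gt0.
have kappaP (w : 'rV[int]_d) : sqnorm R w < r ^+ 2 ->
    kappa <= bump A w - walk_mean (bump A) w.
  move=> wr; apply: le_trans (drift w); have w0 := sqnorm_ge0 R w.
  have b1 : (2 ^+ n)^-1 <= bump A w.
    by rewrite -[leLHS]mulr1 mulrC ler_pdivrMr// mulrC near1.
  have q1 : (4 * A)^-1 <= A / (sqnorm R w + A) ^+ 2.
    rewrite -[leLHS]mul1r ler_pdivrMr; last by rewrite mulr_gt0.
    rewrite mulrAC ler_pdivlMr; last by rewrite exprn_gt0//; lra.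
    by nra.
  rewrite (_ : kappa = 4^-1 * ((2 ^+ n)^-1 * (4 * A)^-1)); last first.
    by rewrite /kappa; field; rewrite !lt0r_neq0.
  apply: ler_wpM2l => //; apply: ler_pM => //; rewrite invr_ge0 ?ltW//.
  by rewrite mulr_gt0.
pose mu (z : 'rV[int]_d) : R :=
  \sum_(x <- U) kappa * ((sqnorm R (z - x) < r ^+ 2)%R : bool)%:R.
have := @charge_ge _ _ F v (potential A U) mu (6 * 2 ^+ n) (2 ^+ n)
  v1 sv hv (@potential_ge0 _ _ A U) spot (potential_vanishing U sb vb).
set E := \sum_(x <- F) (v x - walk_mean v x) => H.
have {}H : \sum_(x <- F) mu x <= 6 * 2 ^+ n * E.
  apply: H.
  - move=> z /mem_nbhd[//|x xU zx].
    have := @potential_compare _ _ A U z (x - z) A0.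
    rewrite -sqnormN opprB => /(_ (le_trans (ltW zx) r2A)).
    rewrite [z + _]addrC subrK => /le_trans; apply.
    by rewrite mulrC; apply: ler_wpM2r; [exact: ltW|exact: U6].
  - exact: ltW.
  - apply: vmin.
    + by move=> z; rewrite mulr_ge0 ?potential_ge0// ltW.
    + by move=> z; rewrite mE ler_pM2l.
    + move=> z /mem_nbhd[//|x xU zx]; apply: le_trans (near1 _ zx) _.
      rewrite ler_pM2l// /potential (big_fsetD1 x)//= lerDl.
      by apply: sumr_ge0 => y _; exact: bump_ge0.
  - by move=> z; apply: sumr_ge0 => x _; rewrite mulr_ge0// ltW.
  - move=> z zF; rewrite /mu big_seq big1// => x xU.
    have [zx|zx] := boolP (sqnorm R (z - x) < r ^+ 2); last by rewrite mulr0.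
    by case/mem_nbhd : zF => //; exists x.
  - move=> z; rewrite walk_mean_potential /potential -sumrB.
    apply: ler_sum => x _.
    have [zx|zx] := boolP (sqnorm R (z - x) < r ^+ 2).
      by rewrite mulr1 kappaP.
    by rewrite mulr0 subr_ge0 sb.
have [s [us sr ss]] := @ball_card_ge R d r r1.
have : \sum_(x <- U) kappa * (r / d.+1%:R) ^+ d <= \sum_(x <- F) mu x.
  rewrite /mu exchange_big/= big_seq [leRHS]big_seq; apply: ler_sum => x xU.
  rewrite -mulr_sumr ler_pM2l//; apply: le_trans ss _.
  rewrite -natr_sum ler_nat.
  rewrite (eq_bigr (fun z => if (sqnorm R (z - x) < r ^+ 2)%R then 1 else 0)%N);
    last by move=> z _; case: ifP.
  rewrite -big_mkcond sum1_count -size_filter -(size_map (+%R x) s).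
  apply: uniq_leq_size; first by rewrite map_inj_uniq//; exact: addrI.
  move=> _ /mapP[w ws ->]; have wr := sr w ws.
  rewrite mem_filter [x + w - x]addrAC subrr add0r wr/=.
  by apply/mem_nbhd => //; exists x => //;
    rewrite [x + w - x]addrAC subrr add0r.
move=> /le_trans/(_ H).
rewrite big_const_seq count_predT iter_addr_0 -[_ *+ _]mulr_natr => {}H.
set Q := 16 * 2 ^+ n * a * d.+1%:R ^+ d.
have Q0 : 0 < Q by rewrite !mulr_gt0 ?exprn_gt0//; lra.
have -> : 6 * 2 ^+ n * Q * E = Q * (6 * 2 ^+ n * E) by ring.
rewrite -ler_pdivrMl//; apply: le_trans H.
rewrite mulrA; apply: ler_wpM2r => //.
rewrite [leLHS](_ : _ = kappa * (r / d.+1%:R) ^+ d)// /kappa /Q AE expr_div_n.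
rewrite (_ : r ^+ d = r ^+ n * r ^+ 2); last first.
  by rewrite -exprD /n; congr (_ ^+ _); lia.
have D0 : (d.+1%:R : R) ^+ d != 0 by rewrite lt0r_neq0// exprn_gt0.
move: (d.+1%:R ^+ d) D0 => D D0.
by field; rewrite D0 !lt0r_neq0//; lra.
Qed.

Unset Implicit Arguments.

Theorem theorem1p1 (R : realType) (d : nat) (hd : (3 <= d)%N) :
  exists alpha : R, 0 < alpha /\
    forall (disp : measure_display) (Omega : measurableType disp)
           (P : 'rV[int]_d -> probability Omega R)
           (S : nat -> Omega -> 'rV[int]_d),
      (forall x : 'rV[int]_d, simple_random_walk (P x) S x) ->
      forall (r : R) (C : {fset 'rV[int]_d}), 1 <= r ->
        exists U : {fset 'rV[int]_d},
          [/\ (U `<=` C)%fset,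
              alpha * r ^+ (d - 2) * #|` U|%:R
                <= cap P S (lattice_nbhd r [set` U])
            & alpha * cap P S (lattice_nbhd r [set` C])
                <= r ^+ (d - 2) * #|` U|%:R].
Proof.
have [a a40 drift] := bump_mean_bounds R hd.
set n := (d - 2)%N in drift *.
pose c1 : R := 6 * 2 ^+ n * (16 * 2 ^+ n * a * d.+1%:R ^+ d).
pose c2 : R := 2 ^+ n * (n%:R * (2 * 5 ^+ d * Num.sqrt a ^+ n)).
have c10 : 0 < c1 by rewrite !mulr_gt0 ?exprn_gt0//; lra.
have c20 : 0 < c2.
  rewrite !mulr_gt0 ?exprn_gt0 ?sqrtr_gt0 ?ltr0n//; last by lra.
  by rewrite /n; lia.
exists (Num.min c1^-1 (2 * c2)^-1); split.
  by rewrite lt_min !invr_gt0 c10 mulr_gt0.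
move=> disp Omega P S PS r C r1.
pose A := a * r ^+ 2.
have r2 : 1 <= r ^+ 2 by exact: exprn_ege1.
have aA : a <= A by rewrite /A ler_peMr//; lra.
have A0 : 0 < A by lra.
have [W [WC CW EW]] := @greedy_subset R _ (fun x y => bump A (x - y)) C
  (fun x y => etrans (esym (bumpN A (x - y))) (congr1 _ (opprB x y)))
  (fun x => etrans (congr1 _ (subrr x)) (bump0 d A0))
  (fun x y => bump_ge0 A (x - y)).
pose U := [fset x in W | potential A W x <= 6]%fset.
have UW : (U `<=` W)%fset by exact: fset_sub.
have r0 : 0 <= r ^+ n by rewrite exprn_ge0//; lra.
have WU : #|` W|%:R <= 2 * #|` U|%:R :> R.
  have : \sum_(x <- W) (6 - 6 * (x \in U)%:R) <=
         \sum_(x <- W) potential A W x :> R.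
    rewrite big_seq [leRHS]big_seq; apply: ler_sum => x xW.
    have [_|xU] := boolP (x \in U); first by rewrite mulr1 subrr potential_ge0.
    by rewrite mulr0 subr0 ltW// ltNge; move: xU; rewrite !inE xW.
  have -> : \sum_(x <- W) (6 - 6 * (x \in U)%:R) =
            6 * #|` W|%:R - 6 * #|` U|%:R :> R.
    rewrite sumrB -mulr_sumr; congr (_ - 6 * _).
      by rewrite big_const_seq count_predT iter_addr_0 mulr_natr.
    rewrite -natr_sum; congr _%:R.
    rewrite (eq_bigr (fun x => if x \in U then 1 else 0)%N);
      last by move=> x _; case: ifP.
    rewrite -big_mkcond sum1_count -size_filter; apply: perm_size.
    apply: uniq_perm; rewrite ?filter_uniq ?fset_uniq// => x.
    rewrite mem_filter; apply: andb_idr => xU.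
    by move/fsubsetP : UW; apply.
  by move=> /le_trans/(_ EW); lra.
have U6 x : x \in U -> potential A U x <= 6.
  rewrite !inE => /andP[_]; apply: le_trans; rewrite /potential.
  rewrite [leRHS](big_fsetID _ (mem U) W)/=.
  rewrite [X in _ <= X + _](_ : _ = potential A U x).
    by rewrite lerDl; apply: sumr_ge0 => y _; exact: bump_ge0.
  rewrite /potential; apply: eq_fbigl => y; rewrite !inE/=.
  by case: (y \in W).
have a1 : 1 <= a by lra.
have lo := @cap_nbhd_ge R d a A disp Omega P S r U hd PS r1 a1 erefl
  (fun x => (drift A x aA).1) U6.
have up := @cap_nbhd_le R d a A disp Omega P S r C W hd PS r1 a1 erefl
  (fun x => drift A x aA) CW.
exists U; split; first exact: fsubset_trans UW WC.
  apply: (@le_trans _ _ (c1^-1 * (r ^+ n * #|` U|%:R))).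
    by rewrite -mulrA ler_wpM2r ?mulr_ge0// ge_min lexx.
  by rewrite ler_pdivrMl.
have capU : cap P S (lattice_nbhd r [set` C]) <=
            (2 * c2) * (r ^+ n * #|` U|%:R).
  apply: (@le_trans _ _ (c2 * (r ^+ n * #|` W|%:R))); first exact: up.
  rewrite (_ : 2 * c2 * _ = c2 * (r ^+ n * (2 * #|` U|%:R))); last by ring.
  by rewrite ler_pM2l//; apply: ler_wpM2l.
have m0 : 0 < 2 * c2 by rewrite mulr_gt0.
have [c0|/ltW c0] := leP 0 (cap P S (lattice_nbhd r [set` C])).
  apply: (@le_trans _ _ ((2 * c2)^-1 * cap P S (lattice_nbhd r [set` C]))).
    by rewrite ler_wpM2r// ge_min lexx orbT.
  by rewrite ler_pdivrMl.
apply: (@le_trans _ _ 0); last by rewrite mulr_ge0.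
by rewrite mulr_ge0_le0// le_min !invr_ge0 !ltW.
Qed.
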